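(* Let $A$ and $B$ be compact metric spaces such that $\dim_H A > \overline{\dim}_B B$. Then there exist a compact set $A'\subset A$ and a Lipschitz onto map $f\colon A'\to B$.
   Context: $\dim_H$ denotes Hausdorff dimension. For a compact metric space $X$ and $r>0$ let $N(X,r)$ be the minimal number of closed balls $\overline{B}(x,r)=\{y\in X: d(x,y)\le r\}$ (with $x\in X$) that cover $X$. The upper box dimension is $\overline{\dim}_B X=\limsup_{r\to 0+}\frac{\log N(X,r)}{\log(1/r)}\in[0,\infty]$ for nonempty $X$ (the dimensions of the empty set are taken to be $0$). A map $f$ between metric spaces $(X,d_X)$ and $(Y,d_Y)$ is Lipschitz if there is a finite $C$ with $d_Y(f(x),f(z))\le C\,d_X(x,z)$ for all $x,z\in X$. *)

(* Defs.v *)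
From HB Require Import structures.
From mathcomp Require Import all_boot all_order all_algebra.
From mathcomp Require Import all_classical all_reals all_analysis.

Set Implicit Arguments.
Unset Strict Implicit.
Unset Printing Implicit Defensive.

Import Order.TTheory GRing.Theory Num.Theory.
Import numFieldNormedType.Exports.

Local Open Scope classical_set_scope.
Local Open Scope ring_scope.
Local Open Scope ereal_scope.

(* The maximum with 0 only matters for U = set0, where the supremum is -oo. *)
Definition diam (R : realType) (X : metricType R) (U : set X) : \bar R :=
  maxe 0 (ereal_sup [set (mdist xy.1 xy.2)%:E | xy in U `*` U]).

(* diam U ^ s, where the empty set counts 0 even for s = 0 (while a singleton
   counts 0 `^ 0 = 1), so that the measure of exponent 0 is the counting
   measure. *)
Definition diam_pow (R : realType) (X : metricType R) (s : R) (U : set X) :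
    \bar R :=
  if U == set0 then 0 else poweR (diam U) s.

Definition hausdorff_premeasure (R : realType) (X : metricType R)
    (s delta : R) (E : set X) : \bar R :=
  ereal_inf [set \sum_(0 <= i <oo) diam_pow s (U i) |
    U in [set U : nat -> set X |
      (forall i, diam (U i) <= delta%:E) /\ E `<=` \bigcup_i U i]].

Definition hausdorff_measure (R : realType) (X : metricType R)
    (s : R) (E : set X) : \bar R :=
  ereal_sup [set hausdorff_premeasure s delta E |
    delta in [set delta : R | (0 < delta)%R]].

Definition hausdorff_dim (R : realType) (X : metricType R) (E : set X) :
    \bar R :=
  ereal_inf [set s%:E |
    s in [set s : R | (0 <= s)%R /\ hausdorff_measure s E = 0]].

(* This is not the library's closed_ball, which is the closure of the open ball
   and may be strictly smaller in a general metric space. *)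
Definition cball (R : realType) (X : metricType R) (x : X) (r : R) : set X :=
  [set y | (mdist x y <= r)%R].

(* For compact E and r > 0 the infimum is over a nonempty set of natural
   numbers, hence a minimum; it is +oo if there is no finite cover. *)
Definition covering_number (R : realType) (X : metricType R)
    (E : set X) (r : R) : \bar R :=
  ereal_inf [set ((size c)%:R : R)%:E |
    c in [set c : seq X | [set` c] `<=` E /\
                          E `<=` \bigcup_(x in [set` c]) cball x r]].

Definition upper_box_dim (R : realType) (X : metricType R) (E : set X) :
    \bar R :=
  if E == set0 then 0
  else limf_esup (fun r : R => lne (covering_number E r) / (ln r^-1)%:E)
                 (0%R : R)^'+.

(* f is only defined on the subset D, seen as a type. *)
Definition lipschitz_map (R : realType) (X Y : metricType R) (D : set X)
    (f : D -> Y) : Prop :=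
  exists C : R, forall x z : D,
    (mdist (f x) (f z) <= C * mdist (val x) (val z))%R.

(* Main.v *)
Require Import Defs.
From HB Require Import structures.
From mathcomp Require Import all_boot all_order all_algebra.
From mathcomp Require Import all_classical all_reals all_analysis.
From mathcomp Require Import ring lra.

Set Implicit Arguments.
Unset Strict Implicit.
Unset Printing Implicit Defensive.

Import Order.TTheory GRing.Theory Num.Theory.
Import numFieldNormedType.Exports.

Local Open Scope classical_set_scope.
Local Open Scope ring_scope.

(** Choose exponents [upper_box_dim B < t < s < hausdorff_dim A].

   The set [A] contains, at every finite resolution [4^-n], finite sets carrying
   a map to a fixed interval [[0, x0]] that is Hölder with an exponent larger
   than [t] at all scales down to [4^-n] and has a [b^n]-dense image
   ([b = 4^-s'] with [t < s' < s]). Such a set is built as a tree: a set [V] of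
   diameter [4^-k] is cut into subsets of diameter [4^-(k+1)] at mutual distance
   of order [4^-k], and their intervals are concatenated, so only the length of
   the interval of each node must be at most [b^k]. Let [w] be the Hausdorff
   premeasure and [p < 1]. One shows that [V] carries an interval of length about
   [w(V)^p]. The cut is made by growing balls, which loses only a factor close to
   1 as long as the small balls of [V] have a mass comparable with [w(V)]. If not,
   [V] is diffuse: either growing balls yields many pieces of very small relative
   mass, and the concavity of [x^p] gives a large gain, or there are many far
   apart balls that are far more diffuse still, and one recurses into these. Only
   monotonicity and subadditivity of [w] are used, so no measure on [A] is needed.

   The set [B] is covered by at most [4^(tk)] balls of radius [4^-k], hence its
   points can be placed in [[0, x0]], in the lexicographic order of a tree of nets
   with gaps [b^k] between the nodes of level [k], such that points of [B] at
   distance more than [4^-k] have positions more than [b^k] apart. Composing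
   yields relations between [A] and [B] that are Lipschitz up to [O(4^-n)], and an
   ultrafilter limit of these is the graph of the required map. *)

(** * Finite sets that spread over an interval *)

Section Spread.
Local Open Scope set_scope.
Variables (R : realType) (T : finType) (d : T -> T -> R) (g b e : R).
Hypotheses (d0 : forall x, d x x = 0) (dC : forall x y, d x y = d y x).
Hypotheses (g_gt0 : 0 < g) (b_gt0 : 0 < b) (b_le1 : b <= 1).
Implicit Types V W S : {set T}.

(* [f] sends a subset of [V] to an [e]-dense subset of the half-open interval
   [[0, x[]; this makes [spread V 0] true also for empty [V]. The last clause says
   that [f] is Hölder with exponent [ln b / ln (1/4)]. *)
Definition spread V (x : R) : Prop :=
  exists (S : {set T}) (f : T -> R),
    [/\ S \subset V,
        forall u, u \in S -> 0 <= f u <= x,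
        forall z, 0 <= z < x -> exists2 u, u \in S & f u <= z <= f u + e &
        forall u v j, u \in S -> v \in S ->
          d u v < g / 4 ^+ j -> `|f u - f v| <= b ^+ j.+1].

Lemma spread0 V : spread V 0.
Proof.
exists finset.set0, (fun=> 0); split => [|u|z|u v j]; rewrite ?finset.sub0set ?inE //.
by move=> /andP[/le_lt_trans h] /h; rewrite ltxx.
Qed.

Lemma spreadS V W x : V \subset W -> spread V x -> spread W x.
Proof.
move=> VW [S [f [SV fx fe fd]]]; exists S, f; split => //.
exact: fintype.subset_trans VW.
Qed.

Lemma spread_le V x y : 0 <= y <= x -> spread V x -> spread V y.
Proof.
move=> /andP[y0 yx] [S [f [SV fx fe fd]]].
exists [set u in S | f u <= y], f; split.
- by apply/fintype.subsetP => u; rewrite inE => /andP[/(fintype.subsetP SV)].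
- by move=> u; rewrite inE => /andP[/fx/andP[-> _] ->].
- move=> z /andP[z0 zy]; have [|u uS /andP[fz zf]] := fe z.
    by rewrite z0 (lt_le_trans zy).
  by exists u; rewrite ?fz ?inE ?uS ?(le_trans fz (ltW zy)).
- by move=> u v j; rewrite !inE => /andP[uS _] /andP[vS _]; exact: fd.
Qed.

Lemma spread1 V u y : u \in V -> y <= e -> spread V y.
Proof.
have [y0|y0 uV ye] := ltP y 0.
  exists finset.set0, (fun=> 0); split => [|v|z|v w j]; rewrite ?finset.sub0set ?inE //.
  by move=> /andP[/le_lt_trans h] /h /(lt_trans y0); rewrite ltxx.
exists [set u], (fun=> 0); split.
- by rewrite finset.sub1set.
- by move=> v _; rewrite lexx y0.
- move=> z /andP[z0 zy]; exists u; rewrite ?inE// z0 add0r.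
  by rewrite (le_trans (ltW zy)).
- by move=> v w j _ _ _; rewrite subrr normr0 exprn_ge0// ltW.
Qed.

Definition separated (r : R) V W := forall u v, u \in V -> v \in W -> r <= d u v.

(** The interval of [W] is shifted behind that of [V]. For points of different pieces at distance
    below [g / 4 ^+ j], the separation forces [j < k], so the total length, at most [b ^+ k], is at
    most [b ^+ j.+1]. *)
Lemma spreadU k V W x y : 0 <= x -> 0 <= y -> x + y <= b ^+ k ->
  separated (g / 4 ^+ k) V W -> spread V x -> spread W y ->
  spread (V :|: W) (x + y).
Proof.
move=> x0 y0 xyb VW [S [f [SV fx fe fd]]] [S' [f' [SW fy fe' fd']]].
have SS' u : u \in S -> u \notin S'.
  move=> /(fintype.subsetP SV) uV; apply/negP => /(fintype.subsetP SW) /(VW _ _ uV).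
  by rewrite d0 leNgt divr_gt0// exprn_gt0.
pose h u := if u \in S then f u else x + f' u.
have h1 u : u \in S -> h u = f u by rewrite /h => ->.
have h2 u : u \in S' -> h u = x + f' u.
  by rewrite /h; case: ifP => // /SS' /negbTE ->.
have hb u : u \in S :|: S' -> 0 <= h u <= x + y.
  rewrite inE => /orP[uS|uS].
    by rewrite h1//; have := fx _ uS; lra.
  by rewrite h2//; have := fy _ uS; lra.
exists (S :|: S'), h; split => //.
- exact: finset.setUSS.
- move=> z /andP[z0 zxy]; have [zx|xz] := ltP z x.
    have [|u uS fz] := fe z; first by rewrite z0.
    by exists u; rewrite ?inE ?uS// h1.
  have [|u uS fz] := fe' (z - x); first lra.
  by exists u; rewrite ?inE ?uS ?orbT// h2//; lra.
- suff H u v j : u \in S -> v \in S' -> d u v < g / 4 ^+ j ->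
      `|h u - h v| <= b ^+ j.+1.
    move=> u v j; rewrite !inE => /orP[uS|uS] /orP[vS|vS] duv.
    + by rewrite !h1//; exact: fd.
    + exact: H.
    + by rewrite distrC; apply: H => //; rewrite dC.
    + rewrite !h2// (_ : x + f' u - _ = f' u - f' v); last by ring.
      exact: fd'.
  move=> uS vS duv.
  have jk : (j < k)%N.
    rewrite ltnNge; apply/negP => kj.
    have : g / 4 ^+ j <= g / 4 ^+ k.
      by rewrite ler_pM2l// lef_pV2 ?posrE ?exprn_gt0// ler_weXn2l ?ler1n.
    have := VW _ _ (fintype.subsetP SV _ uS) (fintype.subsetP SW _ vS).
    by move=> h3 h4; move: duv; rewrite ltNge (le_trans h4 h3).
  apply: (@le_trans _ _ (x + y)).
    have := hb u; have := hb v; rewrite !inE uS vS orbT => /(_ isT) ? /(_ isT) ?.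
    by rewrite ler_norml; lra.
  by apply: (le_trans xyb); rewrite ler_wiXn2l// ltW.
Qed.

Lemma spreadU_min k V W x y : 0 <= x -> 0 <= y ->
  separated (g / 4 ^+ k) V W -> spread V x -> spread W (Num.min (b ^+ k) y) ->
  spread (V :|: W) (Num.min (b ^+ k) (x + y)).
Proof.
move=> x0 y0 VW Vx Wy; have bk : 0 < b ^+ k by rewrite exprn_gt0.
set y' := Num.min _ y in Wy.
have y'0 : 0 <= y' by rewrite /y' le_min y0 ltW.
have y'b : y' <= b ^+ k by rewrite /y' ge_min lexx.
(* The interval of [V] is shortened to the room that the one of [W] leaves below the cap. *)
pose x' := Num.min x (b ^+ k - y').
have x'0 : 0 <= x' by rewrite /x' le_min x0 subr_ge0.
have -> : Num.min (b ^+ k) (x + y) = x' + y'.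
  by rewrite /x' /y' !minEle; repeat case: ifP; lra.
apply: (spreadU (k := k)) => //.
  by rewrite -lerBrDr /x' ge_min lexx orbT.
by apply: spread_le Vx; rewrite x'0 /x' ge_min lexx.
Qed.

End Spread.

(** * Carving a finite set into separated pieces *)

(* A function that grows by less than [A^L] in [L] steps has a step of factor at
   most [A]: this selects the radius at which a growing ball is cut out. *)
Lemma slow_growth (R : realDomainType) (f : nat -> R) (A : R) L : 0 <= A ->
  f L < A ^+ L * f 0%N -> exists2 i, (i < L)%N & f i.+1 <= A * f i.
Proof.
move=> A0; elim: L => [|L IH]; first by rewrite expr0 mul1r ltxx.
have [fL|fL] := leP (f L.+1) (A * f L); first by exists L.
rewrite exprS -mulrA => h; have [|i iL fi] := IH.
  rewrite ltNge; apply/negP => /(ler_wpM2l A0) h'.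
  by have := lt_trans (lt_le_trans h h') fL; rewrite ltxx.
by exists i => //; exact: ltnW.
Qed.

Section Carving.
Local Open Scope set_scope.
Variables (R : realType) (T : finType) (d : T -> T -> R) (w : {set T} -> R).
Hypotheses (d0 : forall x, d x x = 0) (dC : forall x y, d x y = d y x).
Hypothesis (dD : forall x y z, d x z <= d x y + d y z).
Hypotheses (w0 : w finset.set0 = 0).
Hypotheses (wS : forall V W : {set T}, V \subset W -> w V <= w W).
Hypotheses (wU : forall V W : {set T}, w (V :|: W) <= w V + w W).
Implicit Types U V W : {set T}.

Definition dball x r U := [set y in U | d x y <= r].

Lemma w_ge0 V : 0 <= w V.
Proof. by rewrite -w0 wS// finset.sub0set. Qed.

Lemma dballS x r U : dball x r U \subset U.
Proof. by apply/fintype.subsetP => y; rewrite inE => /andP[]. Qed.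

Lemma dball_mono x r r' U U' : r <= r' -> U \subset U' ->
  dball x r U \subset dball x r' U'.
Proof.
move=> rr' /fintype.subsetP UU'; apply/fintype.subsetP => y.
by rewrite !inE => /andP[/UU' -> /le_trans ->].
Qed.

Lemma w_setD U V : w U <= w V + w (U :\: V).
Proof.
apply: le_trans (wU _ _); apply: wS.
by apply/fintype.subsetP => x xU; rewrite !inE xU andbT orbN.
Qed.

(** [Q] and [P] are consecutive balls at the step found by [slow_growth]; the shell of width [t]
    between them separates [Q] from the rest. *)
Lemma ball_cut x r t (A : R) L U : 0 <= r -> 0 <= t -> 0 <= A ->
    w (dball x (r + L%:R * t) U) < A ^+ L * w (dball x r U) -> x \in U ->
  exists Q P : {set T}, [/\ Q \subset dball x (r + L%:R * t) U, P \subset U,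
    x \in P, w P <= A * w Q & separated d t Q (U :\: P)].
Proof.
move=> r0 t0 A0 h xU; pose f i := w (dball x (r + i%:R * t) U).
have [|i iL fi] := @slow_growth _ f A L A0; first by rewrite /f mul0r addr0.
exists (dball x (r + i%:R * t) U), (dball x (r + i.+1%:R * t) U); split => //.
- apply: dball_mono => //; rewrite lerD2l ler_wpM2r// ler_nat; exact: ltnW.
- exact: dballS.
- by rewrite !inE xU d0 addr_ge0// mulr_ge0.
- move=> u v; rewrite !inE => /andP[_ xu] /andP[]; case: (v \in U) => //=.
  rewrite -ltNge -natr1 mulrDl mul1r => xv _.
  have := dD x u v; lra.
Qed.

Variables (g b : R) (n : nat).
Hypotheses (g_gt0 : 0 < g) (b_gt0 : 0 < b) (b_le1 : b <= 1).
Local Notation spread := (spread d g b (b ^+ n)).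

Variables (Dt p dl qs : R) (L N m : nat).
Local Notation D k := (Dt / 4 ^+ k).
Local Notation eps := (1 - p).
Local Notation gam := ((1 - p) / 4).
Local Notation sg := ((1 - dl) ^- 2).
Local Notation bounded V r := (forall x y, x \in V -> y \in V -> d x y <= r).
Hypotheses (Dt_gt0 : 0 < Dt) (p_gt0 : 0 < p) (p_lt1 : p < 1).
Hypotheses (dl_gt0 : 0 < dl) (dl_lt1 : dl < 1).
Hypotheses (qs_gt0 : 0 < qs) (qs_lt1 : qs < 1).
Hypothesis (w_cap : forall k V, (k <= n)%N -> bounded V (D k) ->
  sg ^+ k * w V `^ p <= b ^+ k).
(** By [mb], [m] pieces of length [b ^+ k.+1] fill [b ^+ k]; by [mq], [m] balls of relative mass
    [qs] hold at most half of the mass. By [qs2] and [qsdl], a factor [qs^(-gam)] pays for halving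
    the mass, or for keeping only a fraction [dl] of it. [LN] and [Ldl] limit the growth of balls in
    the diffuse and in the dense case. *)
Hypotheses (mb : 1 <= m%:R * b) (mq : m%:R * qs <= 2^-1).
Hypotheses (qs2 : 2 <= qs `^ (- gam)) (qsdl : 1 <= qs `^ (- gam) * dl `^ p).
Hypotheses (Ngam : p <= gam * N%:R).
Hypotheses (L_gt0 : (0 < L)%N) (LN : N.+1%:R <= eps / 2 * L%:R).
Hypotheses (Ldl : (1 - dl) ^+ L < dl * qs).
Hypotheses (gL : g <= Dt / (64 * L%:R)).

(* The factor [sg^k] pays for the loss of a factor [sg] at each level: by [w_cap]
   it is absorbed by the difference between the exponents of [w] and of [b^k]. *)
Definition large k := forall V, bounded V (D k) -> spread V (sg ^+ k * w V `^ p).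

Definition large_diffuse k := forall V q, bounded V (D k) -> 0 < q <= qs ->
  (forall x, x \in V -> w (dball x (D k / 16) V) <= q * w V) ->
  spread V (Num.min (b ^+ k) (q `^ (- gam) * (sg ^+ k * w V `^ p))).

Lemma sg_gt0 : 0 < sg.
Proof. by rewrite invr_gt0 exprn_gt0// subr_gt0. Qed.

Lemma D_gt0 k : 0 < D k.
Proof. by rewrite divr_gt0// exprn_gt0. Qed.

Lemma DS k : D k.+1 = D k / 4.
Proof. by rewrite exprS invfM; ring. Qed.

Lemma gD k : g / 4 ^+ k <= D k / (64 * L%:R).
Proof.
rewrite -mulrA [_ / (64 * _)]mulrC mulrA ler_wpM2r// invr_ge0 exprn_ge0//.
Qed.

(** At the last level lengths do not exceed the density [b ^+ n], so a single point is enough, and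
    positive mass provides one. *)
Lemma spread_base V x : 0 < w V -> x <= b ^+ n -> spread V x.
Proof.
have [->|[u uV]] := finset.set_0Vmem V; first by rewrite w0 ltxx.
by move=> _; apply: spread1 uV.
Qed.

Lemma large_n : large n.
Proof.
move=> V VD; have := w_ge0 V; rewrite le_eqVlt => /orP[/eqP<-|V0].
  by rewrite powR0 ?gt_eqF// mulr0; exact: spread0.
exact/spread_base/w_cap.
Qed.

Lemma large_diffuse_n : large_diffuse n.
Proof.
move=> V q VD q0 _; have := w_ge0 V; rewrite le_eqVlt => /orP[/eqP<-|V0].
  rewrite powR0 ?gt_eqF// !mulr0 min_r ?exprn_ge0 1?ltW//; exact: spread0.
by apply: spread_base => //; rewrite ge_min lexx.
Qed.

Lemma bounded_dball x r V : bounded (dball x r V) (r + r).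
Proof.
move=> y z; rewrite !inE => /andP[_ xy] /andP[_ xz].
by apply: le_trans (dD y x z) _; rewrite lerD// dC.
Qed.

Lemma boundedS V W r r' : V \subset W -> r <= r' -> bounded W r -> bounded V r'.
Proof.
move=> /fintype.subsetP VW rr' Wr x y /VW xW /VW yW.
by apply: le_trans rr'; exact: Wr.
Qed.

Lemma separatedS r r' V W W' : r <= r' -> W \subset W' -> separated d r' V W' ->
  separated d r V W.
Proof.
move=> rr' /fintype.subsetP WW' VW' x y xV /WW'.
by move/(VW' _ _ xV); apply: le_trans.
Qed.

Lemma sg_ge1 : 1 <= sg.
Proof.
by rewrite invf_ge1 ?exprn_gt0 ?subr_gt0// exprn_ile1 ?subr_ge0 ?ltW// gtrBl.
Qed.

Lemma powRN_le (c c' r : R) : 0 < c -> c <= c' -> 0 <= r -> c' `^ (- r) <= c `^ (- r).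
Proof.
move=> c0 cc' r0; have c'0 := lt_le_trans c0 cc'.
rewrite !powRN lef_pV2 ?posrE ?powR_gt0// ge0_ler_powR// nnegrE ltW//.
Qed.

Lemma eps_gt0 : 0 < eps. Proof. by rewrite subr_gt0. Qed.

(** * Diffuse sets *)

Section Diffuse.
Variables (k : nat) (V : {set T}) (q : R).
Hypotheses (V_gt0 : 0 < w V) (q_gt0 : 0 < q) (q_le : q <= qs).
Hypotheses (large_next : large k.+1) (diffuse_next : large_diffuse k.+1).
Hypothesis Vq : forall x, x \in V -> w (dball x (D k / 16) V) <= q * w V.

Local Notation Y := (q `^ (- gam) * (sg ^+ k * w V `^ p)).
Local Notation y := (Num.min (b ^+ k.+1) Y).
Local Notation G := (sg ^+ k.+1 * q `^ (- (eps / 2)) * w V `^ (- eps)).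

Lemma amplified_ge0 : 0 <= Y.
Proof. by rewrite !mulr_ge0 ?powR_ge0// exprn_ge0// ltW// sg_gt0. Qed.

Lemma capped_ge0 : 0 <= y.
Proof. by rewrite le_min exprn_ge0 ?(ltW b_gt0)//= amplified_ge0. Qed.

Lemma diffuse_rate_gt0 : 0 < G.
Proof. by rewrite !mulr_gt0 ?powR_gt0// exprn_gt0// sg_gt0. Qed.

Lemma sgS_le (a : R) : 0 <= a -> sg ^+ k * a <= sg ^+ k.+1 * a.
Proof. by move=> a0; rewrite ler_wpM2r// ler_weXn2l// sg_ge1. Qed.

Lemma gam_gt0 : 0 < gam. Proof. by rewrite divr_gt0// eps_gt0. Qed.
Lemma q_le1 : q <= 1. Proof. exact: le_trans q_le (ltW qs_lt1). Qed.

(** A piece of relative mass [c] that is diffuse with fraction [c^(N+1)] is amplified by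
    [c^(-(N+1) gam)]. By [Ngam] this pays for the factor [c^p] lost in mass and leaves [c^(-gam)],
    which is at least [q^(-gam)]. *)
Lemma amplified_value (c : R) : 0 < c -> c <= q ->
  Y <= (c ^+ N.+1) `^ (- gam) * (sg ^+ k.+1 * (c * w V) `^ p).
Proof.
move=> c0 cq; have c1 := le_trans cq q_le1.
have cg : q `^ (- gam) <= (c ^+ N.+1) `^ (- gam) * c `^ p.
  apply: (le_trans (powRN_le c0 cq (ltW gam_gt0))).
  rewrite -powR_mulrn ?(ltW c0)// -powRrM -powRD; last by rewrite (gt_eqF c0) implybT.
  apply: ger_powR; first by rewrite c0.
  by rewrite -natr1; have := Ngam; lra.
rewrite powRM ?(ltW c0) ?(ltW V_gt0)//.
have -> : (c ^+ N.+1) `^ (- gam) * (sg ^+ k.+1 * (c `^ p * w V `^ p)) =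
  (c ^+ N.+1) `^ (- gam) * c `^ p * (sg ^+ k.+1 * w V `^ p) by ring.
apply: ler_pM; rewrite ?powR_ge0 ?sgS_le ?powR_ge0//.
by rewrite mulr_ge0 ?powR_ge0// exprn_ge0// ltW// sg_gt0.
Qed.

(** Writing [w Q^p] as [w Q * w Q^(-eps)] shows a gain [c^(-eps)]. Half of this exponent pays for
    the growth from [Q] to [P], the other half enters the rate [G]. *)
Lemma compact_value (c : R) (P Q : {set T}) : 0 < c -> c <= q ->
  w P <= c `^ (- (eps / 2)) * w Q -> w Q <= c * w V ->
  G * w P <= sg ^+ k.+1 * w Q `^ p.
Proof.
move=> c0 cq wP wQ.
have := w_ge0 Q; rewrite le_eqVlt => /orP[/eqP Q0|Q0].
  rewrite -Q0 mulr0 in wP; rewrite (@le_trans _ _ 0)//.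
    by rewrite pmulr_rle0// diffuse_rate_gt0.
  by rewrite mulr_ge0 ?powR_ge0// exprn_ge0// ltW// sg_gt0.
have -> : w Q `^ p = w Q * w Q `^ (- eps).
  by rewrite -mulr_powRB1 ?w_ge0// opprB.
have e2 : 0 <= eps / 2 by rewrite divr_ge0// ltW// eps_gt0.
have h1 : (c * w V) `^ (- eps) <= w Q `^ (- eps) by rewrite powRN_le// ltW// eps_gt0.
have h2 := powRN_le c0 cq e2.
rewrite -!mulrA ler_pM2l ?exprn_gt0 ?sg_gt0//.
apply: (@le_trans _ _ (c `^ (- (eps / 2)) * (w V `^ (- eps) * (c `^ (- (eps / 2)) * w Q)))).
  by apply: ler_pM; rewrite ?powR_ge0 ?mulr_ge0 ?powR_ge0 ?w_ge0// ler_wpM2l// powR_ge0.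
have -> : c `^ (- (eps / 2)) * (w V `^ (- eps) * (c `^ (- (eps / 2)) * w Q)) =
  w Q * ((c `^ (- (eps / 2)) * c `^ (- (eps / 2))) * w V `^ (- eps)) by ring.
rewrite ler_pM2l// -powRD; last by rewrite (gt_eqF c0) implybT.
rewrite (_ : - (eps / 2) - eps / 2 = - eps); last by lra.
by rewrite -powRM// ltW.
Qed.

(** As [eps / 2 = 2 gam], the rate [G] contains the gain [q^(-gam)] twice; by [qs2] the second
    factor makes up for having only half of the mass. *)
Lemma diffuse_total (X : R) : G * w V / 2 <= X -> Y <= X.
Proof.
apply: le_trans.
have -> : G * w V / 2 = sg ^+ k.+1 * (q `^ (- gam) * (w V `^ (- eps) * w V)
    * (q `^ (- gam) / 2)).
  have -> : - (eps / 2) = - gam + - gam by lra.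
  by rewrite powRD; [ring|rewrite (gt_eqF q_gt0) implybT].
have -> : w V `^ (- eps) * w V = w V `^ p.
  by rewrite mulrC opprB mulr_powRB1 ?w_ge0.
have q2 : 1 <= q `^ (- gam) / 2.
  have := le_trans qs2 (powRN_le q_gt0 q_le (ltW gam_gt0)); lra.
rewrite mulrCA; apply: (le_trans (sgS_le _)).
  by rewrite mulr_ge0 ?powR_ge0.
by rewrite ler_pM2l ?exprn_gt0 ?sg_gt0// ler_peMr// mulr_ge0 ?powR_ge0.
Qed.

(* Take the heaviest ball left, of relative mass [c]. If all its small balls
   have mass at most [c^(N+2)], it becomes a piece of [Zb], far more diffuse than
   [V], whose value [y] comes from the next level. Otherwise a ball can be
   grown around a small ball that is not so light, and it becomes a piece of [Za].
   Either [Zb] gets [m] pieces, or [Za] receives half of the mass at rate [G]. *)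
Lemma diffuse_carve U : U \subset V ->
  exists (X : R) (j : nat) (Za Zb : {set T}),
  [/\ 0 <= X, Za \subset U, Zb \subset U,
      spread Za (Num.min (b ^+ k) X) /\ spread Zb (Num.min (b ^+ k) (j%:R * y)) &
      G * w U <= X + G * (j%:R * (q * w V))].
Proof.
have [M] := ubnP #|U|; elim: M U => // M IH U cU UV.
have [U0|[x0 x0U]] := finset.set_0Vmem U.
  exists 0, 0%N, finset.set0, finset.set0; split; rewrite ?finset.sub0set//.
    by split; rewrite ?mul0r min_r ?exprn_ge0 1?ltW//; exact: spread0.
  by rewrite U0 w0 mulr0 add0r mul0r mulr0.
have [x xU xmax] : exists2 x, x \in U &
    forall z, z \in U -> w (dball z (D k / 32) U) <= w (dball x (D k / 32) U).
  by have [x xU xmax] := @Order.TotalTheory.arg_maxP _ _ _ x0 (mem U)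
    (fun x => w (dball x (D k / 32) U)) x0U; exists x.
have remP (P : {set T}) z : P \subset U -> z \in P -> exists (X : R) j (Za Zb : {set T}),
  [/\ 0 <= X, Za \subset U :\: P, Zb \subset U :\: P,
      spread Za (Num.min (b ^+ k) X) /\ spread Zb (Num.min (b ^+ k) (j%:R * y)) &
      G * w U <= G * w P + X + G * (j%:R * (q * w V))].
  move=> PU zP.
  have cP : (#|U :\: P| < M)%N.
    rewrite -ltnS (leq_trans _ cU)// ltnS; apply: proper_card.
    apply/properP; split; first exact: finset.subsetDl.
    by exists z; rewrite ?inE ?zP//; exact: (fintype.subsetP PU).
  have [|X [j [Za [Zb [X0 Za' Zb' ZZ h]]]]] := IH _ cP.
    exact: fintype.subset_trans (finset.subsetDl _ _) UV.
  exists X, j, Za, Zb; split => //.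
  have := w_setD U P; rewrite -(ler_pM2l diffuse_rate_gt0) => /le_trans; apply.
  by rewrite mulrDr -addrA lerD2l.
have Dk := D_gt0 k.
have L0 : 0 < L%:R :> R by rewrite ltr0n.
have gD' : g / 4 ^+ k <= D k / 64 / L%:R.
  by have := gD k; rewrite invfM mulrA.
have ULe : D k / 64 / L%:R <= D k / 64.
  by rewrite ler_pdivrMr// ler_peMr ?ler1n// divr_ge0// ltW.
pose u := w (dball x (D k / 32) U).
have := w_ge0 (dball x (D k / 32) U); rewrite le_eqVlt -/u => /orP[/eqP u0|u_gt0].
  have [||X [j [Za [Zb [X0 Za' Zb' [ZZ1 ZZ2] h]]]]] := remP (dball x (D k / 32) U) x.
  - exact: dballS.
  - by rewrite inE xU d0 divr_ge0// ltW.
  exists X, j, Za, Zb; split => //.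
  - exact: fintype.subset_trans Za' (finset.subsetDl _ _).
  - exact: fintype.subset_trans Zb' (finset.subsetDl _ _).
  - by move: h; rewrite -/u -u0 mulr0 add0r.
pose c := u / w V.
have uc : u = c * w V by rewrite /c divfK// gt_eqF.
have c0 : 0 < c by rewrite divr_gt0.
have cq : c <= q.
  rewrite /c ler_pdivrMr//; apply: le_trans (Vq (fintype.subsetP UV _ xU)).
  by apply: wS; apply: dball_mono => //; lra.
have Yc := amplified_value c0 cq.
(* Relative to the mass [c * w V] of the ball itself, [c ^+ N.+2 * w V] is the fraction [c ^+ N.+1],
   the one handed to the next level. *)
have [/fintype.forall_inP Dif|] := boolP [forall z in dball x (D k / 32) U,
   w (dball z (D k.+1 / 16) (dball x (D k / 32) U)) <= c ^+ N.+2 * w V].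
  (* The ball of twice the radius is removed, so that the piece is separated from the rest; the mass
     removed, at most [q * w V], is charged to the count [j]. *)
  have [||X [j [Za [Zb [X0 Za' Zb' [ZZ1 ZZ2] h]]]]] := remP (dball x (D k / 16) U) x.
  - exact: dballS.
  - by rewrite inE xU d0 divr_ge0// ltW.
  exists X, j.+1, Za, (dball x (D k / 32) U :|: Zb); split => //.
  - exact: fintype.subset_trans Za' (finset.subsetDl _ _).
  - rewrite finset.subUset dballS/=.
    exact: fintype.subset_trans Zb' (finset.subsetDl _ _).
  - split=> //; have -> : j.+1%:R * y = y + j%:R * y.
      by rewrite -natr1 mulrDl mul1r [RHS]addrC.
    apply: spreadU_min => //; rewrite ?mulr_ge0 ?capped_ge0//.
    + move=> z z'; rewrite inE => /andP[_ xz] /(fintype.subsetP Zb').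
      rewrite !inE => /andP[]; case: (z' \in U) => //=; rewrite -ltNge => xz' _.
      by have := dD x z z'; lra.
    + apply: (@spread_le _ _ _ _ _ _ _ (Num.min (b ^+ k.+1)
        ((c ^+ N.+1) `^ (- gam) * (sg ^+ k.+1 * u `^ p)))).
        by rewrite capped_ge0/= uc le_min !ge_min lexx/= Yc orbT.
      apply: diffuse_next.
      * by apply: boundedS (fintype.subxx _) _ (@bounded_dball x (D k / 32) U); rewrite DS; lra.
      * have c1 := le_trans cq q_le1.
        rewrite exprn_gt0//= (le_trans _ (le_trans cq q_le))//.
        by rewrite exprS ler_piMr ?exprn_ile1// ltW.
      * by move=> z /Dif; rewrite -/u uc mulrA -exprSr.
  - apply: (le_trans h).
    have -> : G * (j.+1%:R * (q * w V)) = G * (j%:R * (q * w V)) + G * (q * w V).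
      have -> : j.+1%:R = j%:R + 1 :> R by rewrite natr1.
      by rewrite [(j%:R + 1) * _]mulrDl mul1r mulrDr.
    have : G * w (dball x (D k / 16) U) <= G * (q * w V).
      rewrite ler_pM2l ?diffuse_rate_gt0//; apply: le_trans (Vq (fintype.subsetP UV _ xU)).
      by apply: wS; apply: dball_mono.
    by move=> h'; rewrite -[leLHS]addrA [leLHS]addrC -[leLHS]addrA lerD2l lerD2l.
rewrite fintype.negb_forall => /existsP[z]; rewrite negb_imply -ltNge => /andP[zB wz].
have zU : z \in U by move: zB; rewrite inE => /andP[].
have rL : D k / 64 + L%:R * (D k / 64 / L%:R) = D k / 32.
  by rewrite mulrCA divff ?gt_eqF//; lra.
have wzu : w (dball z (D k / 32) U) <= u by exact: xmax.
(* The ball around [z] starts above mass [c ^+ N.+2 * w V] and ends at most as heavy as the heaviest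
   ball, [c * w V]; by [LN], growing by [c^(-eps/2)] in each of [L] steps would exceed this. *)
have [|||||Q [P [Qz PU zP wPQ QP]]] := @ball_cut z (D k / 64) (D k / 64 / L%:R)
    (c `^ (- (eps / 2))) L U.
- by rewrite divr_ge0// ltW.
- by rewrite !divr_ge0// ltW.
- exact: powR_ge0.
- rewrite rL (le_lt_trans wzu)// uc -powR_mulrn ?powR_ge0// -powRrM.
  have -> : D k / 64 = D k.+1 / 16 by rewrite DS; lra.
  have wz' : c ^+ N.+2 * w V < w (dball z (D k.+1 / 16) U).
    by apply: (lt_le_trans wz); apply: wS; apply: dball_mono => //; exact: dballS.
  have cN : c `^ (- N.+1%:R) <= c `^ (- (eps / 2) * L%:R).
    by apply: ger_powR; [rewrite c0 (le_trans cq q_le1)|have := LN; lra].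
  apply: lt_le_trans (ler_wpM2r (w_ge0 _) cN).
  by rewrite powR_invn ?(ltW c0)// ltr_pdivlMl ?exprn_gt0// mulrA -exprSr.
- by [].
have [//|//|X [j [Za [Zb [X0 Za' Zb' [ZZ1 ZZ2] h]]]]] := remP P z.
have QU : Q \subset U by apply: fintype.subset_trans Qz _; exact: dballS.
exists (sg ^+ k.+1 * w Q `^ p + X), j, (Q :|: Za), Zb; split => //.
- by rewrite addr_ge0// mulr_ge0 ?powR_ge0// exprn_ge0// ltW// sg_gt0.
- by rewrite finset.subUset QU (fintype.subset_trans Za' (finset.subsetDl _ _)).
- exact: fintype.subset_trans Zb' (finset.subsetDl _ _).
- split => //; apply: spreadU_min => //.
  + by rewrite mulr_ge0 ?powR_ge0// exprn_ge0// ltW// sg_gt0.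
  + exact: separatedS QP.
  + apply: large_next; apply: boundedS Qz _ (@bounded_dball z _ U).
    by rewrite rL DS; lra.
- apply: (le_trans h); rewrite lerD2r lerD2r.
  apply: compact_value wPQ _ => //; rewrite -uc; apply: le_trans wzu.
  by rewrite -rL; exact: wS.
Qed.

End Diffuse.

Lemma large_diffuse_step k : large k.+1 -> large_diffuse k.+1 -> large_diffuse k.
Proof.
move=> Lk Dk V q VD /andP[q0 qq] Vq.
have := w_ge0 V; rewrite le_eqVlt => /orP[/eqP<-|V0].
  rewrite powR0 ?gt_eqF// !mulr0 min_r ?exprn_ge0 1?ltW//; exact: spread0.
have [X [j [Za [Zb [X0 ZaV ZbV [sa sb] h]]]]] :=
  diffuse_carve V0 q0 qq Lk Dk Vq (subxx _).
set Y := q `^ _ * _ in sb *.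
have Y0 : 0 <= Y by apply: amplified_ge0.
have bk : 0 <= b ^+ k by rewrite exprn_ge0// ltW.
(* With [m] pieces in [Zb], either each has length [b ^+ k.+1] and they fill [b ^+ k], or a single
   one has the amplified length. With fewer, at least half of the mass went into [Za] at rate
   [G]. *)
have [mj|jm] := leqP m j.
  apply: (spreadS ZbV); apply: spread_le sb; rewrite le_min bk Y0/=.
  rewrite le_min !ge_min lexx/=; apply/orP.
  have m0 : 0 < m%:R :> R.
    by have := lt_le_trans ltr01 mb; rewrite pmulr_lgt0.
  have m1 : 1 <= m%:R :> R by move: m0; rewrite ltr0n ler1n.
  have mj' : m%:R <= j%:R :> R by rewrite ler_nat.
  have [bY|Yb] := leP (b ^+ k.+1) Y; [left|right].
    rewrite exprS mulrA ler_peMl//; apply: (le_trans mb).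
    by rewrite ler_wpM2r// ltW.
  by rewrite ler_peMl// (le_trans m1).
apply: (spreadS ZaV); apply: spread_le sa; rewrite le_min bk Y0/=.
rewrite le_min !ge_min lexx/=; apply/orP; right.
apply: (@diffuse_total k V q) => //.
have G0 := diffuse_rate_gt0 k V0 q0.
have : j%:R * (q * w V) <= w V / 2.
  rewrite mulrA mulrC ler_wpM2l ?w_ge0//; apply: le_trans mq.
  by apply: ler_pM => //; [exact: ltW | rewrite ler_nat ltnW].
rewrite -(ler_pM2l G0); lra.
Qed.

(** * Sets with heavy small balls *)

Section Dense.
Variables (k : nat) (V : {set T}).
Hypotheses (V_gt0 : 0 < w V) (large_next : large k.+1).

Local Notation H := (sg ^+ k.+1 * (1 - dl) * w V `^ (- eps)).

Lemma dense_rate_gt0 : 0 < H.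
Proof.
by rewrite !mulr_gt0 ?powR_gt0// ?exprn_gt0// ?subr_gt0// sg_gt0.
Qed.

(** Passing to a subset [Q] of [V] only improves the rate, as [w Q^(-eps)] is at least [w V^(-eps)];
    the factor [1 - dl] pays for the growth from [Q] to [P]. *)
Lemma dense_value (P Q : {set T}) : Q \subset V -> w P <= (1 - dl)^-1 * w Q ->
  H * w P <= sg ^+ k.+1 * w Q `^ p.
Proof.
move=> QV wP; have sk : 0 < sg ^+ k.+1 by rewrite exprn_gt0// sg_gt0.
have := w_ge0 Q; rewrite le_eqVlt => /orP[/eqP Q0|Q0].
  rewrite -Q0 mulr0 in wP; rewrite (@le_trans _ _ 0)//.
    by rewrite pmulr_rle0// dense_rate_gt0.
  by rewrite mulr_ge0 ?powR_ge0// ltW.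
have -> : w Q `^ p = w Q `^ (- eps) * w Q.
  by rewrite mulrC opprB mulr_powRB1 ?w_ge0.
rewrite -!mulrA ler_pM2l// mulrCA; apply: ler_pM; rewrite ?powR_ge0//.
- by rewrite mulr_ge0 ?w_ge0// subr_ge0 ltW.
- by rewrite powRN_le ?wS// ltW// eps_gt0.
- by move: wP; rewrite ler_pdivlMl ?subr_gt0.
Qed.

(* [W] is what remains when no ball of relative mass [dl * qs] is left to grow. *)
Lemma dense_carve U : U \subset V -> exists (X : R) (Z W : {set T}),
  [/\ 0 <= X, Z \subset U, W \subset U,
      spread Z (Num.min (b ^+ k) X) /\
      forall x, x \in W -> w (dball x (D k / 16) W) <= dl * qs * w V &
      H * w U <= X + H * w W].
Proof.
have [M] := ubnP #|U|; elim: M U => // M IH U cU UV.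
have [/fintype.forall_inP Dif|] := boolP [forall z in U,
    w (dball z (D k / 16) U) <= dl * qs * w V].
  exists 0, finset.set0, U; split => //; rewrite ?finset.sub0set ?add0r//.
  by split => //; rewrite min_r ?exprn_ge0 1?ltW//; exact: spread0.
rewrite fintype.negb_forall => /existsP[z]; rewrite negb_imply -ltNge.
move=> /andP[zU wz].
have Dk := D_gt0 k; have L0 : 0 < L%:R :> R by rewrite ltr0n.
have rL : D k / 16 + L%:R * (D k / 16 / L%:R) = D k / 8.
  by rewrite mulrCA divff ?gt_eqF//; lra.
(* The ball starts above [dl * qs * w V] and never exceeds [w V], so [Ldl] excludes a growth by
   [(1 - dl)^-1] in all [L] steps. The final radius [D k / 8] bounds the diameter by [D k.+1]. *)
have [|||||Q [P [Qz PU zP wPQ QP]]] := @ball_cut z (D k / 16) (D k / 16 / L%:R)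
    (1 - dl)^-1 L U.
- by rewrite divr_ge0// ltW.
- by rewrite !divr_ge0// ltW.
- by rewrite invr_ge0 subr_ge0 ltW.
- have dlL : 0 < (1 - dl) ^+ L by rewrite exprn_gt0// subr_gt0.
  rewrite rL exprVn ltr_pdivlMl//.
  apply: le_lt_trans wz; apply: ler_pM; rewrite ?(ltW dlL) ?w_ge0//.
    exact: ltW Ldl.
  by apply: wS; apply: fintype.subset_trans UV; exact: dballS.
- by [].
have QU : Q \subset U by apply: fintype.subset_trans Qz _; exact: dballS.
have [||X [Z [W [X0 ZU WU [sZ hW] h]]]] := IH (U :\: P).
- rewrite -ltnS (leq_trans _ cU)// ltnS; apply: proper_card.
  apply/properP; split; first exact: finset.subsetDl.
  by exists z; rewrite ?inE ?zP.
- exact: fintype.subset_trans (finset.subsetDl _ _) UV.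
exists (sg ^+ k.+1 * w Q `^ p + X), (Q :|: Z), W; split => //.
- by rewrite addr_ge0// mulr_ge0 ?powR_ge0// exprn_ge0// ltW// sg_gt0.
- by rewrite finset.subUset QU (fintype.subset_trans ZU (finset.subsetDl _ _)).
- exact: fintype.subset_trans WU (finset.subsetDl _ _).
- split => //; apply: spreadU_min => //.
  + by rewrite mulr_ge0 ?powR_ge0// exprn_ge0// ltW// sg_gt0.
  + apply: separatedS QP => //; apply: (le_trans (gD k)).
    rewrite invfM mulrA ler_wpM2r ?invr_ge0 ?ler0n// ler_pM2l//.
    by rewrite lef_pV2 ?posrE// ler_nat.
  + apply: large_next; apply: boundedS Qz _ (@bounded_dball z _ U).
    by rewrite rL DS; lra.
- have := w_setD U P; rewrite -(ler_pM2l dense_rate_gt0) => /le_trans; apply.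
  rewrite mulrDr -addrA; apply: lerD h.
  by apply: dense_value wPQ => //; exact: fintype.subset_trans UV.
Qed.

End Dense.

(** If [W] holds at most the fraction [dl] of the mass, the carved pieces suffice: the two factors
    [1 - dl], from growth and from [W], are cancelled by one factor [sg]. Otherwise [W] is diffuse
    with [q = qs], and by [qsdl] its gain makes up for the lost mass. *)
Lemma large_step k : (k < n)%N -> large k.+1 -> large_diffuse k -> large k.
Proof.
move=> kn Lk Dk V VD.
have := w_ge0 V; rewrite le_eqVlt => /orP[/eqP<-|V0].
  by rewrite powR0 ?gt_eqF// mulr0; exact: spread0.
have [X [Z [W [X0 ZV WV [sZ hW] h]]]] := dense_carve V0 Lk (subxx _).
have bk := w_cap (ltnW kn) VD.
have Yp : 0 <= sg ^+ k * w V `^ p.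
  by rewrite mulr_ge0 ?powR_ge0// exprn_ge0// ltW// sg_gt0.
have [Wl|Wl] := leP (w W) (dl * w V); last first.
  have W0 : 0 < w W by apply: le_lt_trans Wl; rewrite mulr_ge0 ?w_ge0// ltW.
  apply: (spreadS WV); apply: (@spread_le _ _ _ _ _ _ _ (Num.min (b ^+ k)
    (qs `^ (- gam) * (sg ^+ k * w W `^ p)))).
    rewrite Yp/= le_min bk/= mulrCA ler_pM2l ?exprn_gt0 ?sg_gt0//.
    have h1 : (dl * w V) `^ p <= w W `^ p.
      rewrite ge0_ler_powR ?nnegrE ?w_ge0 ?(ltW p_gt0) ?(ltW Wl)//.
      by rewrite mulr_ge0 ?w_ge0// ltW.
    have := ler_wpM2l (powR_ge0 qs (- gam)) h1; apply: le_trans.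
    by rewrite powRM ?w_ge0 ?(ltW dl_gt0)// mulrA ler_peMl// powR_ge0.
  apply: Dk => [|//|x xW]; first exact: boundedS WV _ VD.
    by rewrite qs_gt0 lexx.
  apply: (le_trans (hW _ xW)); rewrite mulrAC mulrC ler_pM2l//; exact: ltW.
apply: (spreadS ZV); apply: spread_le sZ; rewrite Yp/= le_min bk/=.
have H0 := dense_rate_gt0 k V0; set H := _ * _ in H0 h.
have HX : H * (w V - dl * w V) <= X.
  move: Wl; rewrite -(ler_pM2l H0) => Wl.
  by rewrite mulrBr lerBlDr; apply: (le_trans h); rewrite lerD2l.
apply: le_trans HX; rewrite /H.
have -> : w V `^ p = w V `^ (- eps) * w V.
  by rewrite mulrC opprB mulr_powRB1 ?w_ge0.
have dl1 : 1 - dl != 0 by rewrite gt_eqF// subr_gt0.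
rewrite [sg ^+ k.+1]exprSr le_eqVlt; apply/orP; left; apply/eqP.
by move: (sg ^+ k) (w V `^ _) => a1 a2; field.
Qed.

Lemma large0 : large 0.
Proof.
suff H i : (i <= n)%N -> large (n - i) /\ large_diffuse (n - i).
  by have [] := H n (leqnn n); rewrite subnn.
elim: i => [_|i IH ni]; first by rewrite subn0; split; [exact: large_n|exact: large_diffuse_n].
have [] := IH (ltnW ni); rewrite -(subnSK ni).
move=> h1 h2; have h3 := large_diffuse_step h1 h2; split => //.
by apply: large_step => //; rewrite ltn_subrL/= (leq_trans _ ni).
Qed.

End Carving.

Lemma exprn_small (R : realType) (x e : R) : 0 <= x < 1 -> 0 < e ->
  exists n, forall m, (n <= m)%N -> x ^+ m < e.
Proof.
move=> /andP[x0 x1] e0.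
have : (fun n => x ^+ n) @ \oo --> (0 : R) by apply: cvg_expr; rewrite ger0_norm.
move=> /cvgrPdist_lt/(_ _ e0)[n _ h]; exists n => m nm.
by have := h m nm; rewrite sub0r normrN ger0_norm// exprn_ge0.
Qed.

Lemma natr_gt (R : realType) (x : R) : exists n : nat, x < n%:R.
Proof.
have [x0|x0] := ltP x 0; first by exists 0%N.
by exists (Num.bound x); exact: archi_boundP.
Qed.

(** All constants are chosen from [b], [p] and [dl], so that [c] is the same for all finite spaces
    and all [n]. *)
Lemma spread_exists (R : realType) (b p dl : R) :
    0 < b <= 1 -> 0 < p < 1 -> 0 < dl < 1 -> exists2 c : R, 0 < c &
  forall (T : finType) (d : T -> T -> R) (w : {set T} -> R) (Dt : R) (n : nat),
    (forall x, d x x = 0) -> (forall x y, d x y = d y x) ->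
    (forall x y z, d x z <= d x y + d y z) ->
    w finset.set0 = 0 ->
    (forall V W : {set T}, fintype.subset (mem V) (mem W) -> w V <= w W) ->
    (forall V W : {set T}, w (V :|: W)%SET <= w V + w W) ->
    0 < Dt ->
    (forall k (V : {set T}), (k <= n)%N ->
       (forall x y, x \in V -> y \in V -> d x y <= Dt / 4 ^+ k) ->
       (1 - dl) ^- 2 ^+ k * w V `^ p <= b ^+ k) ->
  forall V : {set T}, (forall x y, x \in V -> y \in V -> d x y <= Dt) ->
    spread d (c * Dt) b (b ^+ n) V (w V `^ p).
Proof.
move=> /andP[b0 b1] /andP[p0 p1] /andP[dl0 dl1].
set gam := (1 - p) / 4.
have gam0 : 0 < gam by rewrite divr_gt0// subr_gt0.
have [m bm] := natr_gt b^-1.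
have m0 : 0 < m%:R :> R by apply: lt_trans bm; rewrite invr_gt0.
pose z : R := Num.min 2^-1 (dl `^ p).
have z0 : 0 < z by rewrite lt_min powR_gt0// invr_gt0 ltr0n.
pose qs : R := Num.min (2 * m%:R)^-1 (z `^ gam^-1).
have qs0 : 0 < qs by rewrite lt_min powR_gt0// andbT invr_gt0 mulr_gt0.
have qsm : qs <= (2 * m%:R)^-1 by rewrite ge_min lexx.
have qs1 : qs < 1.
  apply: (le_lt_trans qsm); rewrite invf_lt1 ?mulr_gt0//.
  move: m0; rewrite ltr0n -(ler1n R) => m1; apply: (@lt_le_trans _ _ 2).
    by rewrite ltr1n.
  by rewrite ler_peMr.
have zqs : z^-1 <= qs `^ (- gam).
  rewrite powRN lef_pV2 ?posrE ?powR_gt0//.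
  apply: (@le_trans _ _ ((z `^ gam^-1) `^ gam)).
    rewrite ge0_ler_powR ?nnegrE ?powR_ge0 ?(ltW gam0) ?(ltW qs0)//.
    by rewrite /qs ge_min lexx orbT.
  by rewrite -powRrM mulVf ?gt_eqF// powRr1// ltW.
have [N pN] := natr_gt (p / gam).
have [L1 hL1] := natr_gt (N.+1%:R / ((1 - p) / 2)).
have dl01 : 0 <= 1 - dl < 1 by apply/andP; split; lra.
have [L2 hL2] := exprn_small dl01 (mulr_gt0 dl0 qs0).
(* [L1] serves [LN], [L2] serves [Ldl], and the successor makes [L] positive. *)
pose L := (L1 + L2)%N.+1.
exists (64 * L%:R)^-1; first by rewrite invr_gt0 mulr_gt0// ltr0n.
move=> T d w Dt n d0 dC dD w0 wS wU Dt0 cap V VD.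
have := @large0 R T d w d0 dC dD w0 wS wU ((64 * L%:R)^-1 * Dt) b n _ b0 b1 Dt p dl qs
  L N m Dt0 p0 p1 dl0 dl1 qs0 qs1 cap.
have -> : w V `^ p = (1 - dl) ^- 2 ^+ 0 * w V `^ p by rewrite expr0 mul1r.
apply => //.
- by rewrite mulr_gt0// invr_gt0 mulr_gt0// ltr0n.
- by rewrite -ler_pdivrMr// div1r ltW.
- by rewrite -ler_pdivlMl// -invfM mulrC.
- apply: le_trans zqs; rewrite -[leLHS]invrK lef_pV2 ?posrE ?invr_gt0//.
  by rewrite /z ge_min lexx.
- rewrite -ler_pdivrMr ?powR_gt0// div1r; apply: le_trans zqs.
  by rewrite lef_pV2 ?posrE ?powR_gt0// /z ge_min lexx orbT.
- by rewrite mulrC -ler_pdivrMr// ltW.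
- rewrite mulrC -ler_pdivrMr; last by rewrite divr_gt0// subr_gt0.
  by apply: (le_trans (ltW hL1)); rewrite ler_nat leqW ?leq_addr.
- by apply: hL2; rewrite leqW ?leq_addl.
- by rewrite mulrC.
- by rewrite expr0 divr1.
Qed.

(** * Placing the second space on a line *)

Section Positions.
Variables (R : realType) (B : metricType R) (N : nat -> nat) (pt : nat -> nat -> B).
Variables (near_ : nat -> B -> nat) (e : R) (theta : nat -> R).
Hypothesis near_lt : forall k y, (near_ k y < N k)%N.
Hypothesis near_le : forall k y, mdist y (pt k (near_ k y)) <= e / 4 ^+ k.
Hypothesis theta_ge0 : forall k, 0 <= theta k.

(* The node [i] of level [k] is the point [pt k i], for [i < N k]; the parent of a
   node is a nearby node of the previous level. *)
Definition parent k i := near_ k (pt k.+1 i).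

(* The order of the keys is the lexicographic order of the branches. *)
Fixpoint key k i : nat :=
  if k is k'.+1 then key k' (parent k' i) * N k + i else i.

(** Keys can be as large as a product of the [N j]; ranks keep their order but are at most [N k], so
    that level [k] adds at most [theta k * N k] to a position. *)
Definition rank k i := (\sum_(j < N k) (key k j < key k i))%N.

Fixpoint position k i : R :=
  (if k is k'.+1 then position k' (parent k' i) else 0) + theta k * (rank k i)%:R.

Lemma key_inj k i j : (i < N k)%N -> (j < N k)%N -> key k i = key k j -> i = j.
Proof.
case: k => [//|k] iN jN /= /(congr1 (modn^~ (N k.+1))).
by rewrite !modnMDl !modn_small.
Qed.

Lemma key_parent k i j : (i < N k.+1)%N -> (key k.+1 i <= key k.+1 j)%N ->
  (j < N k.+1)%N -> (key k (parent k i) <= key k (parent k j))%N.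
Proof.
move=> iN ij jN; rewrite leqNgt; apply/negP => ji; move: ij => /=; apply/negP.
rewrite -ltnNge; apply: (@leq_trans ((key k (parent k j)).+1 * N k.+1)).
  by rewrite mulSn addnC ltn_add2r.
by rewrite (leq_trans _ (leq_addr _ _))// leq_mul2r ji orbT.
Qed.

Lemma rank_le k i j : (key k i <= key k j)%N -> (rank k i <= rank k j)%N.
Proof.
move=> ij; rewrite /rank; apply: leq_sum => l _; case: ltnP => // li.
by rewrite (leq_trans li ij).
Qed.

Lemma rank_lt k i j : (i < N k)%N -> (key k i < key k j)%N -> (rank k i < rank k j)%N.
Proof.
move=> iN ij; rewrite /rank (bigD1 (Ordinal iN))//= [ltnRHS](bigD1 (Ordinal iN))//=.
rewrite ltnn ij add0n add1n ltnS; apply: leq_sum => l _; case: ltnP => // li.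
by rewrite (leq_trans li (ltnW ij)).
Qed.

Lemma rank_max k i : (rank k i <= N k)%N.
Proof.
rewrite -[leqRHS]card_ord -sum1_card /rank; apply: leq_sum => l _; exact: leq_b1.
Qed.

Lemma position_bound k i : 0 <= position k i <= \sum_(j < k.+1) theta j * (N j)%:R.
Proof.
elim: k i => [|k IH] i /=.
  rewrite big_ord_recr big_ord0 /= !add0r mulr_ge0//= ler_wpM2l// ler_nat.
  exact: rank_max.
have /andP[p0 p1] := IH (parent k i).
rewrite big_ord_recr/= addr_ge0 ?mulr_ge0//= lerD// ler_wpM2l// ler_nat.
exact: rank_max.
Qed.

Lemma position_le k i j : (i < N k)%N -> (j < N k)%N -> (key k i <= key k j)%N ->
  position k i <= position k j.
Proof.
elim: k i j => [|k IH] i j iN jN ij; rewrite /= lerD//;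
  rewrite ?ler_wpM2l ?ler_nat ?rank_le//.
by apply: IH; rewrite ?near_lt//; exact: key_parent.
Qed.

(** Different ancestors at level [k] would leave a gap of at least [theta k], so the ancestor is
    shared. Going from level [l.+1] to [l] costs at most [2 e / 4^l] in distance, and these costs
    sum to the bound. *)
Lemma position_dist n k i j : (k <= n)%N -> (i < N n)%N -> (j < N n)%N ->
  (key n i <= key n j)%N -> position n j - position n i < theta k ->
  mdist (pt n i) (pt n j) <= 8 / 3 * e * (4 ^- k - 4 ^- n).
Proof.
elim: n i j => [|n IH] i j; rewrite leq_eqVlt => /orP[/eqP->|kn] iN jN ij h.
- have -> : i = j.
    apply: (key_inj iN jN); apply/eqP; rewrite eqn_leq ij/= leqNgt; apply/negP => lt.
    move: h; apply/negP; rewrite -leNgt /= !add0r -mulrBr ler_peMr//.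
    by rewrite lerBrDr addrC natr1 ler_nat rank_lt.
  by rewrite mdistxx subrr mulr0.
- by [].
- have -> : i = j.
    apply: (key_inj iN jN); apply/eqP; rewrite eqn_leq ij/= leqNgt; apply/negP => lt.
    move: h; apply/negP; rewrite -leNgt /=.
    have : theta n.+1 <= theta n.+1 * (rank n.+1 j)%:R - theta n.+1 * (rank n.+1 i)%:R.
      by rewrite -mulrBr ler_peMr// lerBrDr addrC natr1 ler_nat rank_lt.
    have : position n (parent n i) <= position n (parent n j).
      by apply: position_le; rewrite ?near_lt//; exact: key_parent.
    lra.
  by rewrite mdistxx subrr mulr0.
- have h1 : mdist (pt n (parent n i)) (pt n (parent n j)) <=
      8 / 3 * e * (4 ^- k - 4 ^- n).
    apply: IH; rewrite ?near_lt//; first exact: key_parent.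
    apply: le_lt_trans h; rewrite /=.
    have : theta n.+1 * (rank n.+1 i)%:R <= theta n.+1 * (rank n.+1 j)%:R.
      by rewrite ler_wpM2l// ler_nat rank_le.
    lra.
  have := near_le n (pt n.+1 i); have := near_le n (pt n.+1 j).
  rewrite -/(parent n i) -/(parent n j) => h2 h3.
  have := metric_triangle (pt n.+1 i) (pt n (parent n i)) (pt n.+1 j).
  have := metric_triangle (pt n (parent n i)) (pt n (parent n j)) (pt n.+1 j).
  rewrite (metric_sym (pt n (parent n j))) exprS invfM.
  move: h1 h2 h3; move: (4 ^- n) (4 ^- k) => x y; lra.
Qed.

Lemma position_sep n k i j : (k <= n)%N -> (i < N n)%N -> (j < N n)%N ->
  `|position n i - position n j| < theta k ->
  mdist (pt n i) (pt n j) <= 8 / 3 * e * (4 ^- k - 4 ^- n).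
Proof.
move=> kn iN jN h; have [ij|ji] := leqP (key n i) (key n j).
  apply: position_dist => //; apply: le_lt_trans h.
  by rewrite distrC; exact: ler_norm.
rewrite metric_sym; apply: position_dist => //; first exact: ltnW.
exact: le_lt_trans (ler_norm _) h.
Qed.

End Positions.

(** * Limits of approximately Lipschitz relations *)

(** The limit [G] of the relations along an ultrafilter is closed, and Lipschitz since the errors
    vanish; so it is the graph of a map on its projection [A'], which is compact. *)
Lemma lipschitz_limit (R : realType) (A B : metricType R)
    (rel_ : nat -> A -> B -> Prop) (C : R) (e : nat -> R) :
    compact [set: A] -> compact [set: B] -> 0 <= C -> e @ \oo --> (0 : R) ->
    (forall n u y u' y', rel_ n u y -> rel_ n u' y' ->
       mdist y y' <= C * mdist u u' + e n) ->
    (forall n b, exists u y, rel_ n u y /\ mdist y b <= e n) ->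
  exists (A' : set A) (f : A' -> B),
    [/\ compact A', lipschitz_map f & range f = [set: B]].
Proof.
move=> cA cB C0 e0 relC relS.
have [U [UU oU]] := ultraFilterLemma (@eventually_filter).
have PU : ProperFilter U by exact: ultra_proper.
pose G a b := forall eta : R, 0 < eta ->
  U [set n | exists u y, [/\ rel_ n u y, mdist a u < eta & mdist b y < eta]].
have eU (eta : R) : 0 < eta -> U [set n | e n < eta].
  move=> eta0; apply: oU; move/cvgrPdist_lt : e0 => /(_ _ eta0).
  apply: filterS => n /=; rewrite sub0r normrN; exact/le_lt_trans/ler_norm.
have GL a b a' b' : G a b -> G a' b' -> mdist b b' <= C * mdist a a'.
  move=> Gab Gab'; apply/ler_addgt0Pr => eta eta0.
  (* Two errors in [A], multiplied by [C], two errors in [B], and [e n]. *)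
  pose t := eta / (2 * C + 3).
  have C3 : 0 < 2 * C + 3 by rewrite ltr_wpDl// mulr_ge0.
  have t0 : 0 < t by rewrite divr_gt0.
  have : U ([set n | e n < t] `&`
      ([set n | exists u y, [/\ rel_ n u y, mdist a u < t & mdist b y < t]] `&`
       [set n | exists u y, [/\ rel_ n u y, mdist a' u < t & mdist b' y < t]])).
    by apply: filterI; [exact: eU|apply: filterI; [exact: Gab|exact: Gab']].
  move=> /filter_ex[n [/= en [[u [y [r1 au y_]]] [u' [y' [r2 au' y'_]]]]]].
  have h1 := relC _ _ _ _ _ r1 r2.
  have h2 := metric_triangle b y b'; have h3 := metric_triangle y y' b'.
  rewrite (metric_sym y' b') in h3.
  have h4 := metric_triangle u a u'; have h5 := metric_triangle a a' u'.
  rewrite (metric_sym u a) in h4.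
  have h6 : C * mdist u u' <= C * (mdist a a' + 2 * t).
    by rewrite ler_wpM2l//; lra.
  have -> : eta = (2 * C + 3) * t by rewrite /t mulrC divfK// gt_eqF.
  have : C * (mdist a a' + 2 * t) = C * mdist a a' + 2 * C * t by ring.
  move: (C * mdist u u') (C * mdist a a') (C * (_ + _)) h1 h6 => x1 x2 x3 h1 h6 h7.
  have -> : (2 * C + 3) * t = 2 * C * t + 3 * t by ring.
  by move: (2 * C * t) h7 => x4 h7; lra.
have Gclosed : closed [set p : A * B | G p.1 p.2].
  move=> [a b] ab eta eta0 /=.
  have eta2 : 0 < eta / 2 by rewrite divr_gt0.
  have [[a' b'] [/= Gab [aa' bb']]] := ab _ (nbhsx_ballx (a, b) (eta / 2) eta2).
  rewrite /= !ballEmdist /= in aa' bb'.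
  apply: filterS (Gab _ eta2) => n [u [y [ruy a'u b'y]]]; exists u, y; split => //.
    by have := metric_triangle a a' u; lra.
  by have := metric_triangle b b' y; lra.
pose A' := fst @` [set p : A * B | G p.1 p.2].
have A'P (x : A') : exists b, G (val x) b.
  by have [[a b] /= Gab <-] := set_valP x; exists b.
pose f (x : A') := projT1 (cid (A'P x)).
have fG (x : A') : G (val x) (f x) by rewrite /f; case: cid.
exists A', f; split.
- apply: continuous_compact.
    by apply: continuous_subspaceT => p; exact: cvg_fst.
  apply: subclosed_compact Gclosed (compact_setX cA cB) _.
  by move=> p _; split.
- by exists C => x z; exact: GL.
- apply/seteqP; split => // b _.
  have [u uP] := choice (relS^~ b).
  have [y uyP] := choice uP.
  (* Along an ultrafilter the cluster point [a] is a limit: a set outside [U] has its complement in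
     [U]. *)
  have [a [_ ua]] := cA (u @ U) _ filterT.
  have Gab : G a b.
    move=> eta eta0.
    have h1 : U [set n | mdist a (u n) < eta].
      have [//|nU] := in_ultra_setVsetC [set n | mdist a (u n) < eta] UU.
      have : nbhs a (ball a eta) by exact: nbhsx_ballx.
      rewrite ballEmdist => /(ua (~` [set x | mdist a x < eta]) _ nU).
      by move=> [x []].
    apply: filterS (filterI h1 (eU _ eta0)) => n [/= au en].
    have [ruy yb] := uyP n; exists (u n), (y n); split => //.
    by rewrite metric_sym (le_lt_trans yb).
  have aA' : A' a by exists (a, b).
  exists (SigSub (mem_set aA')) => //.
  apply: mdist_positivity; apply/eqP; rewrite eq_le mdist_ge0 andbT.
  by have := GL _ _ _ _ (fG (SigSub (mem_set aA'))) Gab; rewrite /= mdistxx mulr0.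
Qed.

(** * Dimensions *)

Section Premeasure.
Variables (R : realType) (X : metricType R).
Implicit Types E F : set X.
Local Open Scope ereal_scope.

Lemma diam_ge0 E : 0 <= diam E.
Proof. by rewrite /diam le_max lexx. Qed.

Lemma diam0 : diam (set0 : set X) = 0.
Proof.
by rewrite /diam setX0 image_set0 ereal_sup0 max_l ?leNye.
Qed.

Lemma diam_le E (r : R) : (0 <= r)%R ->
  (forall x y, E x -> E y -> (mdist x y <= r)%R) -> diam E <= r%:E.
Proof.
move=> r0 Er; rewrite /diam ge_max lee_fin r0/=; apply: ge_ereal_sup.
by move=> _ [[x y] /= [Ex Ey] <-]; rewrite lee_fin; exact: Er.
Qed.

Lemma diam_pow_ge0 s E : 0 <= diam_pow s E.
Proof. by rewrite /diam_pow; case: ifP => // _; exact: poweR_ge0. Qed.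

Lemma diam_pow_le s E (r : R) : (0 <= s)%R -> (0 <= r)%R ->
  (forall x y, E x -> E y -> (mdist x y <= r)%R) ->
  diam_pow s E <= (r `^ s)%:E.
Proof.
move=> s0 r0 Er; rewrite /diam_pow; case: ifP => _.
  by rewrite lee_fin powR_ge0.
have := diam_le r0 Er; have := diam_ge0 E.
case: (diam E) => [d| |] //=; rewrite !lee_fin => d0 dr.
by rewrite ge0_ler_powR// nnegrE.
Qed.

Local Notation mu := (@hausdorff_premeasure R X).

Lemma premeasure_ge0 s r E : 0 <= mu s r E.
Proof.
apply: le_ereal_inf_tmp => _ [U _ <-].
by apply: nneseries_ge0 => n _ _; exact: diam_pow_ge0.
Qed.

Lemma premeasureS s r E F : E `<=` F -> mu s r E <= mu s r F.
Proof.
move=> EF; apply: le_ereal_inf_tmp => _ [U [Ur FU] <-].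
by apply: ereal_inf_lbound; exists U => //; split => //; exact: subset_trans FU.
Qed.

Lemma premeasure_le s r E : (0 <= r)%R -> diam E <= r%:E -> mu s r E <= diam_pow s E.
Proof.
move=> r0 Er; apply: ge_ereal_inf.
exists (\sum_(0 <= i <oo) diam_pow s (if i == 0%N then E else set0)).
  exists (fun i => if i == 0%N then E else set0) => //; split.
    by move=> i; case: ifP => // _; rewrite diam0 lee_fin.
  by move=> x Ex; exists 0%N.
rewrite (nneseries_split 0%N 1%N); last by move=> i _; exact: diam_pow_ge0.
rewrite big_nat1/= eseries0 ?adde0// => -[//|i] _ _ /=.
by rewrite /diam_pow eqxx.
Qed.

Lemma premeasure0 s r : (0 <= r)%R -> mu s r set0 = 0.
Proof.
move=> r0; apply/eqP; rewrite eq_le premeasure_ge0 andbT.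
have := @premeasure_le s r set0 r0; rewrite diam0 lee_fin => /(_ r0).
by rewrite /diam_pow eqxx.
Qed.

Lemma premeasureU s r E F : mu s r (E `|` F) <= mu s r E + mu s r F.
Proof.
have [->|Eoo] := eqVneq (mu s r E) +oo.
  by rewrite addye ?leey// gt_eqF// (lt_le_trans _ (premeasure_ge0 _ _ _)).
have [->|Foo] := eqVneq (mu s r F) +oo.
  by rewrite addey ?leey// gt_eqF// (lt_le_trans _ (premeasure_ge0 _ _ _)).
have Efin : mu s r E \is a fin_num by rewrite ge0_fin_numE ?premeasure_ge0// ltey.
have Ffin : mu s r F \is a fin_num by rewrite ge0_fin_numE ?premeasure_ge0// ltey.
apply/lee_addgt0Pr => e e0; have e2 : (0 < e / 2)%R by rewrite divr_gt0.
have [_ [U [Ur EU] <-] hU] := lb_ereal_inf_adherent e2 Efin.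
have [_ [V [Vr FV] <-] hV] := lb_ereal_inf_adherent e2 Ffin.
pose Z i := if odd i then V i./2 else U i./2.
have Z2 n : \sum_(0 <= i < n.*2) diam_pow s (Z i) =
    \sum_(0 <= i < n) diam_pow s (U i) + \sum_(0 <= i < n) diam_pow s (V i).
  elim: n => [|n IH]; first by rewrite !big_nil adde0.
  rewrite doubleS !big_nat_recr//= IH /Z/= odd_double/= doubleK uphalf_double.
  by rewrite -!addeA; congr (_ + _); rewrite addeCA.
apply: (@le_trans _ _ (\sum_(0 <= i <oo) diam_pow s (Z i))).
  apply: ereal_inf_lbound; exists Z => //; split.
    by move=> i; rewrite /Z; case: ifP.
  move=> x [/EU[i _ Ui]|/FV[i _ Vi]].
    by exists i.*2 => //; rewrite /Z odd_double doubleK.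
  by exists i.*2.+1 => //; rewrite /Z/= odd_double/= uphalf_double.
apply: (@le_trans _ _ (\sum_(0 <= i <oo) diam_pow s (U i) +
                       \sum_(0 <= i <oo) diam_pow s (V i))).
  apply: lime_le; first by apply: is_cvg_nneseries => n _ _; exact: diam_pow_ge0.
  apply: nearW => n; apply: (@le_trans _ _ (\sum_(0 <= i < n.*2) diam_pow s (Z i))).
    rewrite -addnn (big_cat_nat (leq0n _) (leq_addr n n))/= leeDl//.
    by apply: sume_ge0 => i _; exact: diam_pow_ge0.
  rewrite Z2; apply: leeD; apply: nneseries_lim_ge => i _ _; exact: diam_pow_ge0.
apply: (le_trans (leeD (ltW hU) (ltW hV))).
by rewrite addeACA -EFinD -splitr.
Qed.

End Premeasure.

(** Near-covering compactness is used with the filter of lists containing a given list, which merges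
    the local choices of a centre. *)
Lemma compact_net (R : realType) (X : metricType R) (r : R) :
  compact [set: X] -> 0 < r ->
  exists c : seq X, forall x, exists2 z, z \in c & mdist z x < r.
Proof.
move=> /compact_near_coveringP cX r0.
pose F : set_system (seq X) :=
  filter_from setT (fun c0 : seq X => [set c : seq X | {subset c0 <= c}]).
have FF : Filter F.
  apply: filter_from_filter; first by exists [::].
  move=> c1 c2 _ _; exists (c1 ++ c2) => // c h; split=> x xc; apply: h.
    by rewrite mem_cat xc.
  by rewrite mem_cat xc orbT.
have [|c0 _ h] := cX _ F (fun c x => exists2 z, z \in c & mdist z x < r) FF.
  move=> x _; exists ([set y | mdist x y < r], [set c : seq X | x \in c]).
    split; last by exists [:: x] => // c /(_ x); rewrite mem_head; exact.
    by have := nbhsx_ballx x r r0; rewrite ballEmdist.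
  by move=> [y c] [/= xy xc]; exists x.
by exists c0 => x; exact: h.
Qed.

(** By subadditivity the balls of a finite net cannot all be null. For small [e] such a ball is its
    own cover, which makes premeasures inside it finite. *)
Lemma premeasure_ball_gt0 (R : realType) (X : metricType R) (s r e : R) :
    compact [set: X] -> 0 <= r -> 0 < e ->
    (0 < hausdorff_premeasure s r [set: X])%E ->
  exists z : X, (0 < hausdorff_premeasure s r [set y | mdist z y < e]%R)%E.
Proof.
move=> cX r0 e0 X0; have [c cP] := compact_net cX e0.
apply: contrapT => /forallNP h; move: X0; apply/negP; rewrite -leNgt.
suff H : (hausdorff_premeasure s r
    [set y : X | exists2 z, z \in c & mdist z y < e]%R <= 0)%E.
  by apply: le_trans H; apply: premeasureS => x _; exact: cP.
elim: {cP}c => [|z c IH].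
  rewrite -(premeasure0 X s r0); apply: premeasureS => y [z].
  by rewrite in_nil.
have -> : [set y | exists2 z0, z0 \in z :: c & mdist z0 y < e] =
    [set y | mdist z y < e] `|` [set y | exists2 z0, z0 \in c & mdist z0 y < e].
  apply/seteqP; split => y /=.
    move=> [u]; rewrite in_cons => /orP[/eqP->|uc] uy; first by left.
    by right; exists u.
  move=> [zy|[u uc uy]]; first by exists z => //; rewrite mem_head.
  by exists u => //; rewrite in_cons uc orbT.
apply: (le_trans (premeasureU _ _ _ _)).
by rewrite -[0%E]adde0; apply: leeD => //; rewrite leNgt; exact/negP.
Qed.

Lemma premeasure_gt0 (R : realType) (X : metricType R) (s : R) : 0 <= s ->
  (s%:E < hausdorff_dim [set: X])%E ->
  exists2 r : R, 0 < r & (0 < hausdorff_premeasure s r [set: X])%E.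
Proof.
move=> s0 sX; apply: contrapT => h; move: sX; apply/negP; rewrite -leNgt.
apply: ereal_inf_lbound; exists s => //; split => //.
apply/eqP; rewrite eq_le; apply/andP; split.
  apply: ge_ereal_sup => _ [r r0 <-]; rewrite leNgt; apply/negP => hr.
  by apply: h; exists r.
apply: (@le_trans _ _ (hausdorff_premeasure s 1 [set: X])).
  exact: premeasure_ge0.
by apply: ereal_sup_ubound; exists 1 => //=; rewrite ltr01.
Qed.

Lemma powR_expr (R : realType) (x p : R) k : 0 <= x ->
  (x `^ p) ^+ k = (x ^+ k) `^ p.
Proof.
move=> x0; elim: k => [|k IH]; first by rewrite !expr0 powR1.
by rewrite !exprS IH powRM// exprn_ge0.
Qed.

Lemma powR_inv (R : realType) (x p : R) : 0 <= x -> x^-1 `^ p = (x `^ p)^-1.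
Proof. by move=> x0; rewrite -powRN -powR_inv1// -powRrM mulN1r. Qed.

Lemma spread_dim (R : realType) (A : metricType R) (s b p dl : R) :
    compact [set: A] -> 0 <= s -> (s%:E < hausdorff_dim [set: A])%E ->
    0 < b <= 1 -> 0 < p < 1 -> 0 < dl < 1 ->
    (1 - dl) ^- 2 * (4 `^ (- s)) `^ p <= b ->
  exists g x0 : R, [/\ 0 < g, 0 < x0 & forall n, exists (T : finType) (c : T -> A) V,
    spread (fun i j => mdist (c i) (c j)) g b (b ^+ n) V x0].
Proof.
move=> cA s0 sA b01 p01 dl01 hb; have [r r0 rA] := premeasure_gt0 s0 sA.
have [c0 c00 Hc] := spread_exists b01 p01 dl01.
have [b0 b1] := andP b01; have [p0 p1] := andP p01; have [dl0 dl1] := andP dl01.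
(* The factor 3 leaves room for thickening a set of diameter [Dt / 4 ^+ k] by [Dt / 4 ^+ n / 4]. *)
pose Dt := r / 3; have Dt0 : 0 < Dt by rewrite divr_gt0.
have Dt4 : 0 < Dt / 4 by rewrite divr_gt0.
have [z zE] := premeasure_ball_gt0 cA (ltW r0) Dt4 rA.
set E0 := [set y | mdist z y < Dt / 4] in zE.
have mule F (k : nat) : F `<=` E0 -> (forall x y, F x -> F y -> mdist x y <= r / 4 ^+ k) ->
    (hausdorff_premeasure s r F <= ((r / 4 ^+ k) `^ s)%:E)%E.
  move=> FE Fk; have rk0 : 0 <= r / 4 ^+ k by rewrite divr_ge0 ?exprn_ge0// ltW.
  apply: le_trans (premeasure_le _ (ltW r0) _) (diam_pow_le s0 rk0 Fk).
  apply: (le_trans (diam_le rk0 Fk)); rewrite lee_fin ler_pdivrMr ?exprn_gt0//.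
  by rewrite ler_peMr ?(ltW r0)// exprn_ege1// ler1n.
have E0r : forall x y, E0 x -> E0 y -> mdist x y <= r / 4 ^+ 0.
  move=> x y /= zx zy; rewrite expr0 divr1.
  have := metric_triangle x z y; rewrite (metric_sym x z).
  move: zx zy (r0); rewrite /E0 /Dt/=; lra.
have fin F : F `<=` E0 -> hausdorff_premeasure s r F \is a fin_num.
  move=> FE; rewrite ge0_fin_numE ?premeasure_ge0//.
  apply: (le_lt_trans (premeasureS s r FE)).
  exact: (le_lt_trans (mule _ _ (@subset_refl _ _) E0r) (ltry _)).
have rs0 : 0 < r `^ s by rewrite powR_gt0.
(* The length is computed from [E0], hence independent of [n]; dividing by [r^s] turns [(r / 4^k)^s]
   into [(4^(-s))^k]. *)
exists (c0 * Dt), ((fine (hausdorff_premeasure s r E0) / r `^ s) `^ p).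
split => [||n]; first by rewrite mulr_gt0.
  by rewrite powR_gt0// divr_gt0// fine_gt0// zE -ge0_fin_numE ?fin// ltW.
have e0 : 0 < Dt / 4 ^+ n / 4 by rewrite !divr_gt0// exprn_gt0.
have [c cP] := compact_net cA e0.
pose pt (i : 'I_(size c)) := tnth (in_tuple c) i.
(* The mass of a set of indices is the premeasure of the part of [E0] near it. *)
pose thick (V : {set 'I_(size c)}) :=
  [set y : A | E0 y /\ exists2 i, i \in V & mdist (pt i) y < Dt / 4 ^+ n / 4].
pose w (V : {set 'I_(size c)}) := fine (hausdorff_premeasure s r (thick V)) / r `^ s.
have thE V : thick V `<=` E0 by move=> y [].
pose V0 : {set 'I_(size c)} :=
  [set i | `[< exists2 y, E0 y & mdist (pt i) y < Dt / 4 ^+ n / 4 >]]%SET.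
exists 'I_(size c), pt, V0.
have thV0 : thick V0 = E0.
  apply/seteqP; split => // y Ey; split => //.
  have [u uc uy] := cP y; have [i iE] := tnthP (in_tuple c) u uc.
  exists i; last by rewrite /pt -iE.
  by rewrite inE; apply/asboolP; exists y; rewrite // /pt -iE.
rewrite -thV0; apply: (Hc _ _ w Dt n).
- by move=> x; exact: mdistxx.
- by move=> x y; exact: metric_sym.
- by move=> x y t; exact: metric_triangle.
- rewrite /w (_ : thick _ = set0) ?premeasure0 ?mul0r// ?ltW//.
  by apply/seteqP; split => // y [_ [i]]; rewrite inE.
- move=> V W VW; rewrite /w ler_pM2r ?invr_gt0// fine_le ?fin//.
  apply: premeasureS => y [Ey [i iV iy]]; split => //; exists i => //.
  exact: (fintype.subsetP VW).
- move=> V W; rewrite /w -mulrDl ler_pM2r ?invr_gt0// -fineD ?fin//.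
  rewrite fine_le ?fin_numD ?fin//; apply: le_trans (premeasureU _ _ _ _).
  apply: premeasureS => y [Ey [i]]; rewrite inE => /orP[iV|iV] iy.
    by left; split => //; exists i.
  by right; split => //; exists i.
- by [].
- move=> k V kn Vk.
  have Dkn : Dt / 4 ^+ n <= Dt / 4 ^+ k.
    by rewrite ler_pM2l// lef_pV2 ?posrE ?exprn_gt0// ler_weXn2l// ler1n.
  have wV : w V <= (4 `^ (- s)) ^+ k.
    rewrite /w ler_pdivrMr//.
    have -> : (4 `^ (- s)) ^+ k * r `^ s = (r / 4 ^+ k) `^ s.
      by rewrite powRM ?invr_ge0 ?exprn_ge0 ?(ltW r0)// mulrC -exprVn -powR_expr
        ?invr_ge0// powRN powR_inv.
    rewrite -lee_fin fineK ?fin//; apply: mule => // x y [_ [i iV ix]] [_ [j jV jy]].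
    have := metric_triangle x (pt i) y; have := metric_triangle (pt i) (pt j) y.
    rewrite (metric_sym x (pt i)); have := Vk i j iV jV.
    have -> : r / 4 ^+ k = 3 * (Dt / 4 ^+ k) by rewrite /Dt mulrA [3 * _]mulrC divfK.
    move: (Dt / 4 ^+ n) (Dt / 4 ^+ k) Dkn ix jy e0 => t1 t2; lra.
  apply: (@le_trans _ _ (((1 - dl) ^- 2 * (4 `^ (- s)) `^ p) ^+ k)).
    rewrite exprMn ler_wpM2l ?exprn_ge0 ?invr_ge0 ?exprn_ge0 ?subr_ge0 ?(ltW dl1)//.
    rewrite powR_expr ?powR_ge0//.
    rewrite ge0_ler_powR ?nnegrE ?exprn_ge0 ?powR_ge0 ?(ltW p0)//.
    by rewrite divr_ge0 ?fine_ge0 ?premeasure_ge0 ?ltW.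
  apply: lerXn2r; rewrite ?nnegrE ?(ltW b0)//.
  by rewrite mulr_ge0 ?powR_ge0// invr_ge0 exprn_ge0// subr_ge0 ltW.
- move=> i j; rewrite !inE => -[x Ex ix] [y Ey jy].
  have := metric_triangle (pt i) x (pt j); have := metric_triangle x y (pt j).
  have := metric_triangle x z y; rewrite (metric_sym x z) (metric_sym y (pt j)).
  have Dkn : Dt / 4 ^+ n <= Dt.
    by rewrite ler_pdivrMr ?exprn_gt0// ler_peMr ?(ltW Dt0)// exprn_ege1// ler1n.
  move: Ex Ey; rewrite /E0/=.
  move: (Dt / 4 ^+ n) Dkn ix jy e0 => t1; lra.
Qed.

(** * Nets from the upper box dimension *)

Lemma limf_esup_at_right_lt (R : realType) (f : R -> \bar R) (x : \bar R) :
  (limf_esup f (0 : R)^'+ < x)%E ->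
  exists2 e, 0 < e & forall r, 0 < r < e -> (f r < x)%E.
Proof.
rewrite limf_esupE => /ereal_inf_lt[_ [V V0 <-] Vx].
move: V0 => /nbhs_ballP[e /= e0 Ve]; exists e => // r /andP[r0 re].
apply: le_lt_trans Vx; apply: ereal_sup_ubound; exists r => //.
by apply: Ve => //; rewrite /ball/= sub0r normrN gtr0_norm.
Qed.

Lemma covering_number_ge1 (R : realType) (X : metricType R) (x : X) (r : R) :
  (1 <= covering_number [set: X] r)%E.
Proof.
apply: le_ereal_inf_tmp => _ [c [_ cX] <-]; rewrite lee_fin ler1n lt0n size_eq0.
by apply/eqP => c0; have [z] := cX x I; rewrite c0.
Qed.

Lemma upper_box_dim_ge0 (R : realType) (X : metricType R) :
  (0 <= upper_box_dim [set: X])%E.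
Proof.
rewrite /upper_box_dim; case: ifPn => // /set0P[x _]; rewrite leNgt; apply/negP.
move=> /limf_esup_at_right_lt[e e0 he].
pose r : R := Num.min (e / 2) 2^-1.
have r0 : 0 < r by rewrite lt_min divr_gt0//= invr_gt0.
have re : 0 < r < e by rewrite r0 gt_min ltr_pdivrMr// ltr_pMr// ltr1n.
have r1 : r < 1 by rewrite gt_min invf_lt1// ltr1n orbT.
have := he _ re; apply/negP; rewrite -leNgt.
by rewrite mule_ge0 ?lne_ge0 ?covering_number_ge1// inve_ge0 lee_fin ln_ge0// invf_ge1// ltW.
Qed.

Lemma net_upper_box_dim (R : realType) (X : metricType R) (t : R) (x : X) :
    (upper_box_dim [set: X] < t%:E)%E ->
  exists k0, forall k, (k0 <= k)%N -> exists c : seq X,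
    (size c)%:R <= (4 `^ t) ^+ k /\ forall y, exists2 z, z \in c & mdist z y <= 4 ^- k.
Proof.
have [X0|_] := eqVneq [set: X] set0; first by have : [set: X] x by []; rewrite X0.
rewrite /upper_box_dim ifF; last by apply/eqP => h; have : [set: X] x by []; rewrite h.
move=> /limf_esup_at_right_lt[e e0 he].
have i4 : 0 <= (4^-1 : R) < 1 by rewrite invr_ge0 ler0n/= invf_lt1// ltr1n.
have [k0 hk0] := exprn_small i4 e0.
(* The successor gives [k > 0], hence a positive [ln (4 ^+ k)]. *)
exists k0.+1 => k kk0.
have r0 : (0 : R) < 4 ^- k by rewrite invr_gt0 exprn_gt0.
have re : 0 < (4 ^- k : R) < e by rewrite r0/= -exprVn hk0// ltnW.
have k4 : 1 < (4 ^+ k : R) by rewrite exprn_egt1 ?ltr1n// -lt0n (leq_ltn_trans _ kk0).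
have ln0 : 0 < ln (4 ^+ k : R) by rewrite ln_gt0.
have := he _ re; rewrite invrK inver gt_eqF// lte_pdivrMr//.
rewrite -EFinM -lte_expeR lneK; last first.
  by rewrite in_itv/= leey andbT (le_trans _ (covering_number_ge1 x _))// lee01.
move=> /ereal_inf_lt[_ [c [_ cX] <-]]; rewrite lte_fin => ct; exists c; split.
  by apply: (le_trans (ltW ct)); rewrite powR_expr// /powR gt_eqF.
by move=> y; have [z zc zy] := cX y I; exists z.
Qed.

(** * The Lipschitz map *)

Lemma geometric_bracket (R : realType) (g z : R) k0 n : z < g / 4 ^+ k0 ->
  z < g / 4 ^+ (k0 + n) \/
  exists2 k, (k < n)%N & g / 4 ^+ (k0 + k.+1) <= z < g / 4 ^+ (k0 + k).
Proof.
move=> z0; elim: n => [|n [IH|[k kn hk]]]; first by left; rewrite addn0.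
  have [h|h] := ltP z (g / 4 ^+ (k0 + n.+1)); first by left.
  by right; exists n; rewrite // h.
by right; exists k => //; exact: ltnW.
Qed.

Lemma compact_diam (R : realType) (X : metricType R) :
  compact [set: X] -> exists2 D : R, 0 <= D & forall x y : X, mdist x y <= D.
Proof.
move=> cX; have [X0|/set0P[x0 _]] := eqVneq [set: X] set0.
  by exists 0 => // x; have : [set: X] x by []; rewrite X0.
have [c cP] := compact_net cX (@ltr01 R).
pose M := \sum_(z <- c) mdist z x0.
have M0 : 0 <= M by apply: sumr_ge0 => z _; exact: mdist_ge0.
have xM x : mdist x x0 <= 1 + M.
  have [z zc zx] := cP x; apply: (le_trans (metric_triangle x z x0)).
  apply: lerD; first by rewrite metric_sym ltW.
  rewrite /M (big_rem z)//= lerDl; apply: sumr_ge0 => u _; exact: mdist_ge0.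
exists (2 + 2 * M); first by rewrite addr_ge0// mulr_ge0.
move=> x y; have := metric_triangle x x0 y; rewrite (metric_sym x0 y).
have := xM x; have := xM y; lra.
Qed.

Lemma sum_geometric_le (R : realFieldType) (r : R) n : 0 <= r < 1 ->
  \sum_(j < n) r ^+ j <= (1 - r)^-1.
Proof.
move=> /andP[r0 r1]; have r1' : 0 < 1 - r by rewrite subr_gt0.
rewrite -div1r ler_pdivlMr// mulrC -opprB mulNr -subrX1 opprB.
by rewrite lerBlDr lerDl exprn_ge0.
Qed.

Lemma finite_relation (R : realType) (A B : metricType R) (beta b g x0 : R) (k1 : nat) :
    compact [set: B] -> B -> 0 < beta -> 0 < b <= 1 -> b * beta < 1 -> 0 < g -> 0 < x0 ->
    (forall k, (k1 <= k)%N -> exists c : seq B, (size c)%:R <= beta ^+ k /\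
       forall y, exists2 z, z \in c & mdist z y <= 4 ^- k) ->
    (forall n, exists (T : finType) (c : T -> A) V,
       spread (fun i j => mdist (c i) (c j)) g b (b ^+ n) V x0) ->
  exists (C : R) (k0 : nat), 0 <= C /\ forall n, exists rel_ : A -> B -> Prop,
    (forall u y u' y', rel_ u y -> rel_ u' y' ->
       mdist y y' <= C * mdist u u' + 8 / 3 * 4 ^- (k0 + n)) /\
    (forall y, exists u z, rel_ u z /\ mdist z y <= 8 / 3 * 4 ^- (k0 + n)).
Proof.
move=> cB y0 beta0 /andP[b0 b1] bb1 g0 x00 netB sprA.
have bb0 : 0 < b * beta by rewrite mulr_gt0.
have bb01 : 0 <= b * beta < 1 by rewrite ltW.
have [k2 hk2] : exists k2, forall k, (k2 <= k)%N ->
    (b * beta) ^+ k < x0 * (1 - b * beta) / 3.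
  by apply: exprn_small => //; rewrite divr_gt0// mulr_gt0// subr_gt0.
(* From level [k1] on the nets exist; starting beyond [k2] keeps all positions below [x0]. *)
pose k0 := (k1 + k2)%N.
have [DB DB0 DBP] := compact_diam cB.
have net k : exists c : seq B, (size c)%:R <= beta ^+ (k0 + k) /\
    forall y, exists2 z, z \in c & mdist z y <= 4 ^- (k0 + k).
  by apply: netB; rewrite /k0 -addnA leq_addr.
have [c cP] := choice net.
pose N k := size (c k); pose pt k i := nth y0 (c k) i.
have near_ex k y : exists i, (i < N k)%N /\ mdist y (pt k i) <= 4 ^- k0 / 4 ^+ k.
  have [_ h] := cP k; have [z zc zy] := h y; exists (index z (c k)).
  by rewrite index_mem /pt nth_index// metric_sym -invfM -exprD.
have near_ex1 k : exists f : B -> nat, forall y,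
    (f y < N k)%N /\ mdist y (pt k (f y)) <= 4 ^- k0 / 4 ^+ k.
  by have [f hf] := choice (near_ex k); exists f.
have [near_ nearP] := choice near_ex1.
have near_lt k y : (near_ k y < N k)%N by have [] := nearP k y.
have near_le k y : mdist y (pt k (near_ k y)) <= 4 ^- k0 / 4 ^+ k by have [] := nearP k y.
(* Values [f] differing by at most [b ^+ (k0 + k).+1], each within that amount below its position,
   give positions at most twice that amount apart, strictly less than [theta k]. *)
pose theta k := 3 * b ^+ (k0 + k).+1.
have theta0 k : 0 <= theta k by rewrite mulr_ge0// exprn_ge0// ltW.
pose pos := position N pt near_ theta.
have pos_lt n i : 0 <= pos n i < x0.
  have /andP[-> /=] := position_bound N pt near_ theta0 n i.
  move=> /le_lt_trans; apply.
  apply: (@le_lt_trans _ _ (3 * (b * beta) ^+ k0 * \sum_(j < n.+1) (b * beta) ^+ j)).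
    rewrite mulr_sumr; apply: ler_sum => j _.
    rewrite /theta -!mulrA ler_pM2l// -exprD exprMn; apply: ler_pM => //.
    - by rewrite exprn_ge0// ltW.
    - by apply: ler_wiXn2l => //; exact: ltW.
    - by have [] := cP j.
  apply: (@le_lt_trans _ _ (3 * (b * beta) ^+ k0 * (1 - b * beta)^-1)).
    by rewrite ler_wpM2l ?sum_geometric_le// mulr_ge0// exprn_ge0// ltW.
  rewrite ltr_pdivrMr ?subr_gt0// mulrC -ltr_pdivlMr//.
  by apply: hk2; rewrite /k0 leq_addl.
(* The first term compares [8 / 3 * 4^-(k0 + k)] with a distance of at least [g / 4^(k0 + k + 1)];
   the second handles distances of at least [g / 4^k0] by the diameter bound of [B]. *)
pose C := 32 / 3 / g + DB * 4 ^+ k0 / g.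
have C0 : 0 <= C by rewrite addr_ge0 ?mulr_ge0 ?invr_ge0 ?exprn_ge0// ltW.
exists C, k0; split => // n.
have [T [a [V [S [f [SV fx fe fd]]]]]] := sprA (k0 + n).+1.
exists (fun u y => exists v i, [/\ v \in S, (i < N n)%N, u = a v, y = pt n i &
  f v <= pos n i <= f v + b ^+ (k0 + n).+1]); split; last first.
  move=> y; have [|v vS vy] := fe (pos n (near_ n y)); first exact: pos_lt.
  exists (a v), (pt n (near_ n y)); split; first by exists v, (near_ n y).
  rewrite metric_sym; apply: (le_trans (near_le n y)).
  rewrite -invfM -exprD ler_peMl ?invr_ge0 ?exprn_ge0//; lra.
move=> _ _ _ _ [v [i [vS iN -> -> vi]]] [v' [i' [v'S i'N -> -> vi']]].
have key_step k : (k <= n)%N -> mdist (a v) (a v') < g / 4 ^+ (k0 + k) ->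
    mdist (pt n i) (pt n i') <= 8 / 3 * 4 ^- (k0 + k).
  move=> kn avv; have := fd v v' _ vS v'S avv.
  have bkn : b ^+ (k0 + n).+1 <= b ^+ (k0 + k).+1.
    by apply: ler_wiXn2l; rewrite ?(ltW b0)// ltnS leq_add2l.
  have bk0 : 0 < b ^+ (k0 + k).+1 by rewrite exprn_gt0.
  move=> fvv; have : `|pos n i - pos n i'| < theta k.
    move: fvv; rewrite /theta ler_norml ltr_norml; move: vi vi' bkn bk0.
    move: (b ^+ (k0 + n).+1) (b ^+ (k0 + k).+1) (pos n i) (pos n i').
    by move=> *; lra.
  move=> /(position_sep near_lt near_le theta0 kn iN i'N) /le_trans; apply.
  rewrite -mulrA ler_wpM2l// exprD invfM ler_wpM2l ?invr_ge0 ?exprn_ge0//.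
  by rewrite lerBlDr lerDl invr_ge0 exprn_ge0.
have z0 : 0 <= mdist (a v) (a v') by exact: mdist_ge0.
have e0 : 0 <= (8 / 3 * 4 ^- (k0 + n) : R).
  by rewrite mulr_ge0// invr_ge0 exprn_ge0.
have [zk|zk] := leP (g / 4 ^+ k0) (mdist (a v) (a v')).
  apply: ler_wpDr => //; apply: (le_trans (DBP _ _)).
  have : DB <= DB * 4 ^+ k0 / g * mdist (a v) (a v').
    apply: (@le_trans _ _ (DB * 4 ^+ k0 / g * (g / 4 ^+ k0))).
      have q0 : 4 ^+ k0 != 0 :> R by rewrite gt_eqF// exprn_gt0.
      by rewrite mulrA divfK ?gt_eqF// mulfK.
    by rewrite ler_wpM2l// ?mulr_ge0 ?exprn_ge0// invr_ge0 ltW.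
  move=> /le_trans; apply; rewrite ler_wpM2r// /C lerDr.
  by rewrite divr_ge0// ltW.
have [zn|[k kn /andP[zk1 zk2]]] := @geometric_bracket R g _ k0 n zk.
  by apply: (le_trans (key_step n (leqnn n) zn)); rewrite lerDr mulr_ge0.
apply: ler_wpDr => //; apply: (le_trans (key_step k (ltnW kn) zk2)).
apply: (@le_trans _ _ (32 / 3 / g * (g / 4 ^+ (k0 + k.+1)))).
  rewrite mulrA divfK ?gt_eqF// addnS exprS invfM mulrA ler_wpM2r ?invr_ge0 ?exprn_ge0//.
  lra.
apply: ler_pM => //; first by rewrite divr_ge0// ltW.
  by rewrite divr_ge0 ?exprn_ge0// ltW.
by rewrite /C lerDl mulr_ge0 ?invr_ge0 ?(ltW g0)// mulr_ge0// exprn_ge0.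
Qed.

Lemma ereal_gap (R : realType) (x y : \bar R) : (0 <= x)%E -> (x < y)%E ->
  exists t h : R, [/\ 0 < t, 0 < h, (x < t%:E)%E & ((t + 3 * h)%:E < y)%E].
Proof.
case: x => [x| |] x0; [|by rewrite ltNge leey|by rewrite leeNy_eq in x0].
rewrite lee_fin in x0; case: y => [y| |]; last by rewrite ltNge leNye.
  rewrite lte_fin => xy; exists (x + (y - x) / 5), ((y - x) / 5).
  by rewrite !lte_fin; split; lra.
by exists (x + 1), 1; rewrite !lte_fin ltry; split => //; lra.
Qed.

Theorem theorem1p5 (R : realType) (A B : metricType R)
    (compactA : compact [set: A]) (compactB : compact [set: B])
    (dimAB : (upper_box_dim [set: B] < hausdorff_dim [set: A])%E) :
  exists (A' : set A) (f : A' -> B),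
    [/\ compact A', lipschitz_map f & range f = [set: B]].
Proof.
have [B0|/set0P[y0 _]] := eqVneq [set: B] set0.
  exists set0, (fun x : set0 => False_rect B (set_valP x)); split.
  - exact: compact0.
  - by exists 0 => x; have [] := set_valP x.
  - by apply/seteqP; split => // y; rewrite B0.
have [t [h [t0 h0 Bt Ah]]] := ereal_gap (upper_box_dim_ge0 B) dimAB.
have four1 : 1 < 4 :> R by rewrite ltr1n.
have four0 : 0 < 4 :> R by [].
have pow_lt1 r : 0 < r -> 4 `^ (- r) < 1 :> R.
  move=> r0; rewrite powRN invf_lt1 ?powR_gt0// /powR gt_eqF// expR_gt1.
  by rewrite mulr_gt0// ln_gt0.
pose s := t + 3 * h; have s0 : 0 < s by rewrite addr_gt0// mulr_gt0.
(* Here [b * 4^t = 4^(-h) < 1], while [(4^(-s))^p = 4^(-(t + 2h))] leaves exactly the factor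
   [4^h = (1 - dl)^-2] for the losses. *)
pose b : R := 4 `^ (- (t + h)); pose p := (t + 2 * h) / s; pose dl : R := 1 - 4 `^ (- (h / 2)).
have b01 : 0 < b <= 1 by rewrite powR_gt0//= ltW// pow_lt1// addr_gt0.
have p01 : 0 < p < 1.
  by rewrite divr_gt0 ?addr_gt0 ?mulr_gt0//= ltr_pdivrMr// mul1r /s; lra.
have dl01 : 0 < dl < 1.
  by rewrite subr_gt0 pow_lt1 ?divr_gt0//= gtrBl powR_gt0.
have nz (c : R) : (c == 0) ==> ((4 : R) != 0) by rewrite (gt_eqF four0) implybT.
have bE : (1 - dl) ^- 2 * (4 `^ (- s)) `^ p <= b.
  rewrite /dl subKr expr2 -powRD ?nz// -powRN -powRrM -powRD ?nz// /b.
  by rewrite (_ : _ + _ = - (t + h))// /p mulNr mulrCA divff ?gt_eqF// /s; lra.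
have [g [x0 [g0 x00 spr]]] := spread_dim compactA (ltW s0) Ah b01 p01 dl01 bE.
have beta0 : 0 < 4 `^ t :> R by rewrite powR_gt0.
have bb1 : b * 4 `^ t < 1.
  by rewrite /b -powRD ?nz// (_ : _ + t = - h) ?pow_lt1//; ring.
have [k1 nets] := net_upper_box_dim y0 Bt.
have [C [k0 [C0 rels]]] := finite_relation compactB y0 beta0 b01 bb1 g0 x00 nets spr.
have [rel_ relP] := choice rels.
apply: (@lipschitz_limit R A B rel_ C (fun n => 8 / 3 * 4 ^- (k0 + n)) compactA compactB C0).
- apply/cvgrPdist_lt => e e0.
  have i4 : 0 <= (4^-1 : R) < 1 by rewrite invr_ge0 ler0n/= invf_lt1.
  have e38 : 0 < e * (3 / 8) by rewrite mulr_gt0// divr_gt0.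
  have [n0 hn0] := exprn_small i4 e38; exists n0 => // n /= n0n.
  have := hn0 (k0 + n)%N (leq_trans n0n (leq_addl _ _)).
  have : 0 <= (4^-1 : R) ^+ (k0 + n) by rewrite exprn_ge0// invr_ge0.
  rewrite sub0r normrN -exprVn; move: (4^-1 ^+ _) => q q0 qe.
  by rewrite ger0_norm; [lra | rewrite mulr_ge0].
- by move=> n; have [] := relP n.
- by move=> n; have [] := relP n.
Qed.
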